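(* Let $\mathcal{M}$ be a regular or chiral map (on some surface $S$), and let $\mathrm{Aut}(\mathcal{M})$ be its automorphism group. Then the cardinality of $\mathrm{Ends}(\mathrm{Aut}(\mathcal{M}))$ is either zero or one.
   Context: **Surfaces.** A surface is a connected (Hausdorff, second countable) topological 2-manifold without boundary, compact or not, orientable or not. **Maps.** A map $\mathcal{M}=\mathcal{M}(\Gamma,i,S)$ on a surface $S$ is a 2-cell embedding $i:\Gamma\hookrightarrow S$ of (the geometric realization of) a locally finite simple graph $\Gamma$: only finitely many edges are incident to each vertex, the endpoints of each edge are different vertices, $i$ is a topological embedding, and each connected component of $S\setminus i(\Gamma)$ (a face) is homeomorphic to a disc. **Automorphisms.** A preautomorphism of $\mathcal{M}$ is a homeomorphism $f$ of $S$ for which there is a graph isomorphism $g_f:\Gamma\to\Gamma$ with $i\circ g_f=f\circ i$. Such $g_f$ is unique, and $f\mapsto g_f$ is a group homomorphism $\varphi$ from the group $\widetilde{\mathrm{Aut}}(\mathcal{M})$ of preautomorphisms to the group of isomorphisms of $\Gamma$. Set $\mathrm{Aut}(\mathcal{M}):=\widetilde{\mathrm{Aut}}(\mathcal{M})/\ker\varphi$. **Flags.** A flag of $\mathcal{M}$ is a triangle on $S$ whose vertices are a vertex $i(v)$ of the map, the midpoint of an edge $i(e)$ containing $i(v)$, and an interior point of a face $F$ whose boundary contains $i(e)$ (the same interior point being chosen for all flags of the same face). The flags triangulate $S$. A flag is identified with the ordered incident triple (vertex, edge, face). Given a flag $\Phi$, for $j=0,1,2$ there is a unique $j$-adjacent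 flag $\Phi^j$, differing from $\Phi$ precisely in the vertex, edge, face, respectively. The group $\mathrm{Aut}(\mathcal{M})$ acts on the set $\mathcal{F}$ of flags, and for any two flags there is at most one automorphism mapping the first to the second. **Regular and chiral.** $\mathcal{M}$ is regular if $\mathrm{Aut}(\mathcal{M})$ has exactly one orbit on $\mathcal{F}$. It is chiral if $\mathrm{Aut}(\mathcal{M})$ has exactly two orbits on $\mathcal{F}$ and adjacent flags always belong to different orbits. Regular and chiral maps have a Schläfli type $\{p,q\}$ with $p,q$ finite: every vertex has the same degree $q\in\mathbb{N}$, and the boundary of every face is a cycle of $i(\Gamma)$ of the same finite length $p$. **Ends.** Let $X$ be a locally compact, locally connected, connected Hausdorff space. Consider nested sequences $U_1\supseteq U_2\supseteq\cdots$ of non-empty connected open subsets of $X$ such that each boundary $\partial U_n$ is compact, $\bigcap_n\overline{U_n}=\emptyset$, and for every compact $K\subset X$ there is $m$ with $K\cap U_m=\emptyset$. Two such sequences $(U_n)$, $(U'_n)$ are equivalent if for every $l$ there is $k$ with $U_l\supseteq U'_k$, and for every $n$ there is $m$ with $U'_n\supseteq U_m$. $\mathrm{Ends}(X)$ is the set of equivalence classes. For a finitely generated group $G$, $\mathrm{Ends}(G)$ is the space of ends of (the geometric realization of) the Cayley graph of $G$ with respect to a finite generating set. *)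

(* Defs.v *)
From HB Require Import structures.
From mathcomp Require Import all_boot all_order all_algebra.
From mathcomp Require Import all_classical all_reals all_analysis.

Set Implicit Arguments.
Unset Strict Implicit.
Unset Printing Implicit Defensive.

Import Order.TTheory GRing.Theory Num.Theory.
Import numFieldNormedType.Exports.

Local Open Scope classical_set_scope.
Local Open Scope card_scope.

Definition frontier (X : topologicalType) (A : set X) : set X :=
  closure A `\` A°.

Record homeo (X Y : topologicalType) := Homeo {
  homeo_fun :> X -> Y;
  homeo_inv : Y -> X;
  homeo_funK : cancel homeo_fun homeo_inv;
  homeo_invK : cancel homeo_inv homeo_fun;
  homeo_fun_cont : continuous homeo_fun;
  homeo_inv_cont : continuous homeo_inv }.

Definition homeomorphic (X Y : topologicalType) : Prop := inhabited (homeo X Y).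

Definition topological_embedding (X Y : topologicalType) (i : X -> Y) : Prop :=
  injective i /\
  forall U : set X, open U <-> exists2 W : set Y, open W & U = i @^-1` W.

Lemma homeo_ext (X Y : topologicalType) (f g : homeo X Y) : f =1 g -> f = g.
Proof.
case: f => f f' fK f'K fc f'c; case: g => g g' gK g'K gc g'c /= /funext fg.
subst g; have fg' : f' = g' by apply/funext => y; rewrite -{1}[y]g'K fK.
subst g'; f_equal; exact: Prop_irrelevance.
Qed.

Section HomeoGroup.
Context (X : topologicalType).
Local Notation H := (homeo X X).

HB.instance Definition _ := gen_eqMixin H.
HB.instance Definition _ := gen_choiceMixin H.

Definition homeo_one : H.
Proof. by apply: (@Homeo X X id id) => // x; exact: cvg_id. Defined.

Definition homeo_opp (f : H) : H :=
  Homeo (@homeo_invK _ _ f) (@homeo_funK _ _ f)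
        (@homeo_inv_cont _ _ f) (@homeo_fun_cont _ _ f).

Definition homeo_mul (f g : H) : H.
Proof.
apply: (@Homeo X X (f \o g) (homeo_inv g \o homeo_inv f)).
- by move=> x /=; rewrite !homeo_funK.
- by move=> x /=; rewrite !homeo_invK.
- by move=> x; apply: continuous_comp; exact: homeo_fun_cont.
- by move=> x; apply: continuous_comp; exact: homeo_inv_cont.
Defined.

Lemma homeo_mulA : associative homeo_mul.
Proof. by move=> f g h; apply: homeo_ext. Qed.
Lemma homeo_mul1 : left_id homeo_one homeo_mul.
Proof. by move=> f; apply: homeo_ext. Qed.
Lemma homeo_mulr1 : right_id homeo_one homeo_mul.
Proof. by move=> f; apply: homeo_ext. Qed.
Lemma homeo_mulV : left_inverse homeo_one homeo_opp homeo_mul.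
Proof. by move=> f; apply: homeo_ext => x /=; rewrite homeo_funK. Qed.
Lemma homeo_mulrV : right_inverse homeo_one homeo_opp homeo_mul.
Proof. by move=> f; apply: homeo_ext => x /=; rewrite homeo_invK. Qed.

HB.instance Definition _ := isGroup.Build H
  homeo_mulA homeo_mul1 homeo_mulr1 homeo_mulV homeo_mulrV.
End HomeoGroup.

Section KernelQuotient.
Context (G H : groupType) (phi : {multiplicative G -> H}).
Local Open Scope group_scope.
Local Open Scope quotient_scope.

Definition in_kernel (x : G) : bool := phi x == 1.
Definition ker_rel (x y : G) : bool := in_kernel (x^-1 * y).

Lemma kq_gmulf1 : phi 1 = 1.
Proof. by apply: (@mulIg _ (phi 1)); rewrite -gmulfM !mul1g. Qed.

Lemma kq_gmulfV x : phi x^-1 = (phi x)^-1.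
Proof.
by apply: (@mulIg _ (phi x)); rewrite -gmulfM !mulVg kq_gmulf1.
Qed.

Lemma ker_relE x y : ker_rel x y = (phi x == phi y).
Proof.
rewrite /ker_rel /in_kernel gmulfM kq_gmulfV.
apply/eqP/eqP => [h|->]; last by rewrite mulVg.
by rewrite -[phi y](mulVKg (phi x)) h mulg1.
Qed.

Lemma ker_rel_refl : reflexive ker_rel.
Proof. by move=> x; rewrite ker_relE. Qed.
Lemma ker_rel_sym : symmetric ker_rel.
Proof. by move=> x y; rewrite !ker_relE eq_sym. Qed.
Lemma ker_rel_trans : transitive ker_rel.
Proof. by move=> y x z; rewrite !ker_relE => /eqP ->. Qed.

Canonical ker_equiv := EquivRel ker_rel ker_rel_refl ker_rel_sym ker_rel_trans.

Definition ker_quot := {eq_quot ker_rel}.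
HB.instance Definition _ := Quotient.on ker_quot.
HB.instance Definition _ := Choice.on ker_quot.

Definition kq_one : ker_quot := \pi_ker_quot 1.
Definition kq_inv (x : ker_quot) : ker_quot := \pi_ker_quot (repr x)^-1.
Definition kq_mul (x y : ker_quot) : ker_quot := \pi_ker_quot (repr x * repr y).

Lemma kq_eqP x y : reflect (\pi_ker_quot x = \pi_ker_quot y) (phi x == phi y).
Proof.
rewrite -ker_relE; apply: (iffP idP) => [h|/eqquotP //]; exact/eqquotP.
Qed.

Lemma kq_repr x : phi (repr (\pi_ker_quot x)) = phi x.
Proof. by apply/eqP/kq_eqP; rewrite reprK. Qed.

Lemma kq_mulA : associative kq_mul.
Proof.
by move=> x y z; apply/kq_eqP; rewrite !gmulfM !kq_repr !gmulfM mulgA.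
Qed.
Lemma kq_mul1 : left_id kq_one kq_mul.
Proof.
move=> x; rewrite -[RHS]reprK; apply/kq_eqP.
by rewrite gmulfM kq_repr kq_gmulf1 mul1g.
Qed.
Lemma kq_mulr1 : right_id kq_one kq_mul.
Proof.
move=> x; rewrite -[RHS]reprK; apply/kq_eqP.
by rewrite gmulfM kq_repr kq_gmulf1 mulg1.
Qed.
Lemma kq_mulV : left_inverse kq_one kq_inv kq_mul.
Proof.
by move=> x; apply/kq_eqP; rewrite gmulfM kq_repr kq_gmulfV mulVg kq_gmulf1.
Qed.
Lemma kq_mulrV : right_inverse kq_one kq_inv kq_mul.
Proof.
by move=> x; apply/kq_eqP; rewrite gmulfM kq_repr kq_gmulfV mulgV kq_gmulf1.
Qed.

HB.instance Definition _ := isGroup.Build ker_quot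
  kq_mulA kq_mul1 kq_mulr1 kq_mulV kq_mulrV.
End KernelQuotient.

Record sgraph := SGraph {
  vert :> choiceType;
  adj : rel vert;
  adj_sym : symmetric adj;
  adj_irrefl : irreflexive adj }.

Definition locally_finite (Gamma : sgraph) : Prop :=
  forall u : Gamma, finite_set [set v | adj u v].

(* An edge is identified with the set of its two endpoints. *)
Definition is_edge (Gamma : sgraph) (e : set Gamma) : Prop :=
  exists u v : Gamma, adj u v /\ e = [set u; v].

Record gauto (Gamma : sgraph) := GAuto {
  gauto_fun :> Gamma -> Gamma;
  gauto_inv : Gamma -> Gamma;
  gauto_funK : cancel gauto_fun gauto_inv;
  gauto_invK : cancel gauto_inv gauto_fun;
  gauto_adj : forall u v, adj (gauto_fun u) (gauto_fun v) = adj u v }.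

Lemma gauto_ext (Gamma : sgraph) (f g : gauto Gamma) : f =1 g -> f = g.
Proof.
case: f => f f' fK f'K fa; case: g => g g' gK g'K ga /= /funext fg.
subst g; have fg' : f' = g' by apply/funext => y; rewrite -{1}[y]g'K fK.
subst g'; f_equal; exact: Prop_irrelevance.
Qed.

Section GAutoGroup.
Context (Gamma : sgraph).
Local Notation A := (gauto Gamma).

HB.instance Definition _ := gen_eqMixin A.
HB.instance Definition _ := gen_choiceMixin A.

Definition gauto_one : A.
Proof. by apply: (@GAuto Gamma id id). Defined.

Definition gauto_opp (f : A) : A.
Proof.
apply: (GAuto (@gauto_invK _ f) (@gauto_funK _ f)).
by move=> u v; rewrite -(gauto_adj f) !gauto_invK.
Defined.

Definition gauto_mul (f g : A) : A.
Proof.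
apply: (@GAuto Gamma (f \o g) (gauto_inv g \o gauto_inv f)).
- by move=> x /=; rewrite !gauto_funK.
- by move=> x /=; rewrite !gauto_invK.
- by move=> u v /=; rewrite !gauto_adj.
Defined.

Lemma gauto_mulA : associative gauto_mul.
Proof. by move=> f g h; apply: gauto_ext. Qed.
Lemma gauto_mul1 : left_id gauto_one gauto_mul.
Proof. by move=> f; apply: gauto_ext. Qed.
Lemma gauto_mulr1 : right_id gauto_one gauto_mul.
Proof. by move=> f; apply: gauto_ext. Qed.
Lemma gauto_mulV : left_inverse gauto_one gauto_opp gauto_mul.
Proof. by move=> f; apply: gauto_ext => x /=; rewrite gauto_funK. Qed.
Lemma gauto_mulrV : right_inverse gauto_one gauto_opp gauto_mul.
Proof. by move=> f; apply: gauto_ext => x /=; rewrite gauto_invK. Qed.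

HB.instance Definition _ := isGroup.Build A
  gauto_mulA gauto_mul1 gauto_mulr1 gauto_mulV gauto_mulrV.
End GAutoGroup.

(* Geometric realization in barycentric coordinates.  For a locally finite
   graph the topology of pointwise convergence on it is the CW topology. *)
Section Realization.
Context (R : realType) (Gamma : sgraph).
Local Open Scope ring_scope.

Definition segment (u v : Gamma) : set {ptws Gamma -> R} :=
  [set x | exists2 t : R, 0 <= t <= 1 &
     forall w, x w = (1 - t) * (w == u)%:R + t * (w == v)%:R].

Definition realization_set : set {ptws Gamma -> R} :=
  [set x | exists u v, (u = v \/ adj u v) /\ segment u v x].

Definition realization : topologicalType := set_type realization_set.

Lemma vertex_point_subproof (v : Gamma) :
  ((fun w => (w == v)%:R) : {ptws Gamma -> R}) \in realization_set.
Proof.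
apply/mem_set; exists v, v; split; first by left.
by exists 0; [rewrite lexx ler01 | move=> w; rewrite subr0 mul1r mul0r addr0].
Qed.

Definition vertex_point (v : Gamma) : realization :=
  exist (fun x => x \in realization_set) (fun w => (w == v)%:R)
    (vertex_point_subproof v).

(* For an edge e this is the closed edge of the realization. *)
Definition edge_points (e : set Gamma) : set realization :=
  [set x | forall w, val x w != 0 -> e w].

Lemma realize_subproof (g : gauto Gamma) (x : realization) :
  ((fun w => val x (gauto_inv g w)) : {ptws Gamma -> R}) \in realization_set.
Proof.
case: x => x /= /set_mem [u [v [uv [t t01 xE]]]]; apply/mem_set.
exists (g u), (g v); split; first by case: uv => [->|uv]; [left|right; rewrite gauto_adj].
have geq w z : (gauto_inv g w == z) = (w == g z).
  by apply/eqP/eqP => [<-|->]; rewrite ?gauto_invK ?gauto_funK.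
by exists t => // w; rewrite xE !geq.
Qed.

(* In barycentric coordinates the affine extension of g is x |-> x \o g^-1. *)
Definition realize (g : gauto Gamma) (x : realization) : realization :=
  exist (fun y => y \in realization_set) (fun w => val x (gauto_inv g w))
    (realize_subproof g x).

End Realization.
Arguments vertex_point R {Gamma} v.
Arguments edge_points R {Gamma} e.
Arguments realize R {Gamma} g x.

Definition open_disc (R : realType) : set (R * R) :=
  ([set z | z.1 ^+ 2 + z.2 ^+ 2 < 1])%R.
Arguments open_disc R : clear implicits.

Definition locally_euclidean2 (R : realType) (S : topologicalType) : Prop :=
  forall x : S, exists U : set S, exists W : set (R * R),
    [/\ open U, U x, open W & homeomorphic (set_type U) (set_type W)].

Definition is_surface (R : realType) (S : topologicalType) : Prop :=
  [/\ hausdorff_space S, @second_countable S, connected [set: S] &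
      locally_euclidean2 R S].

Definition faces (S X : topologicalType) (i : X -> S) : set (set S) :=
  [set F | exists2 x, (~` range i) x & F = connected_component (~` range i) x].

Record surface_map (R : realType) := SurfaceMap {
  surf : topologicalType;
  graph : sgraph;
  emb : realization R graph -> surf;
  surfP : is_surface R surf;
  graphP : locally_finite graph;
  embP : topological_embedding emb;
  cellular : forall F : set surf, faces emb F ->
    homeomorphic (set_type F) (set_type (open_disc R)) }.

Section Maps.
Context (R : realType) (M : surface_map R).
Local Notation S := (surf M).
Local Notation V := (graph M).
Local Notation i := (@emb R M).

Definition preauto_graph (f : homeo S S) (g : gauto V) : Prop :=
  f \o i = i \o realize R g.

Definition is_preauto : pred (homeo S S) :=
  fun f => `[< exists g, preauto_graph f g >].

Lemma vertex_point_inj : injective (@vertex_point R V).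
Proof.
move=> u v /(congr1 val) /= /(congr1 (@^~ u)) /=.
rewrite eqxx; case: eqP => // _ /eqP; rewrite oner_eq0 //.
Qed.

Lemma realize_vertex (g : gauto V) v :
  realize R g (vertex_point R v) = vertex_point R (g v).
Proof.
apply: val_inj => /=; apply/funext => w; congr (_%:R)%R; congr nat_of_bool.
by apply/eqP/eqP => [<-|->]; rewrite ?gauto_invK ?gauto_funK.
Qed.

Lemma preauto_graph_unique f g h :
  preauto_graph f g -> preauto_graph f h -> g = h.
Proof.
rewrite /preauto_graph => -> /(congr1 (fun k v => k (vertex_point R v))) /= gh.
apply: gauto_ext => v; apply: vertex_point_inj; rewrite -!realize_vertex.
by apply: (embP M).1; have := congr1 (@^~ v) gh.
Qed.

Lemma preauto_graph1 : preauto_graph 1%g 1%g.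
Proof.
by apply/funext => x /=; congr i; apply: val_inj; apply/funext.
Qed.

Lemma preauto_graphM f f' g g' : preauto_graph f g -> preauto_graph f' g' ->
  preauto_graph (f * f')%g (g * g')%g.
Proof.
move=> fg fg'; apply/funext => x /=.
have /= -> := congr1 (@^~ x) fg'; have /= -> := congr1 (@^~ (realize R g' x)) fg.
by congr i; apply: val_inj.
Qed.

Lemma preauto_graphV f g : preauto_graph f g -> preauto_graph f^-1%g g^-1%g.
Proof.
move=> fg; apply/funext => x /=.
have xE : x = realize R g (realize R g^-1%g x).
  apply: val_inj; apply/funext => w /=.
  by rewrite gauto_invK.
rewrite {1}xE; have /= <- := congr1 (@^~ (realize R g^-1%g x)) fg.
by rewrite homeo_funK.
Qed.

Lemma is_preauto_closed : group_closed is_preauto.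
Proof.
split; first by apply/asboolP; exists 1%g; exact: preauto_graph1.
move=> f f' /asboolP[g fg] /asboolP[g' fg']; apply/asboolP.
by exists (g * g'^-1)%g; apply: preauto_graphM => //; exact: preauto_graphV.
Qed.

Definition preauto := {f : homeo S S | is_preauto f}.
HB.instance Definition _ := SubType.on preauto.
HB.instance Definition _ := Choice.on preauto.
HB.instance Definition _ :=
  SubChoice_isSubGroup.Build _ _ preauto is_preauto_closed.

Definition preauto_phi (f : preauto) : gauto V := projT1 (cid (asboolW (valP f))).

Lemma preauto_phiP (f : preauto) : preauto_graph (val f) (preauto_phi f).
Proof. exact: projT2 (cid (asboolW (valP f))). Qed.

Lemma preauto_phiM : {morph preauto_phi : f h / (f * h)%g}.
Proof.
move=> f h; apply: (preauto_graph_unique (preauto_phiP _)).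
by apply: preauto_graphM; exact: preauto_phiP.
Qed.

HB.instance Definition _ :=
  isMultiplicative.Build preauto (gauto V) preauto_phi preauto_phiM.

Definition Aut : groupType := ker_quot preauto_phi.

Definition Aut_class (f : preauto) : Aut :=
  (\pi_(ker_quot preauto_phi) f)%qT.

Definition flag : Type := (V * set V * set S)%type.

Definition is_flag (Phi : flag) : Prop :=
  let: (v, e, F) := Phi in
  [/\ is_edge e, e v, faces i F & i @` edge_points R e `<=` frontier F].

(* The three coordinates are numbered 0 (vertex), 1 (edge), 2 (face). *)
Definition flag_adjacent (j : 'I_3) (Phi Psi : flag) : Prop :=
  let: (v, e, F) := Phi in let: (v', e', F') := Psi in
  match val j with
  | 0%N => [/\ v <> v', e = e' & F = F']
  | 1%N => [/\ v = v', e <> e' & F = F']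
  | _ => [/\ v = v', e = e' & F <> F']
  end.

Definition unique_adjacent_flags : Prop :=
  forall Phi, is_flag Phi -> forall j : 'I_3,
    exists! Psi, is_flag Psi /\ flag_adjacent j Phi Psi.

Definition flag_act (f : preauto) (Phi : flag) : flag :=
  let: (v, e, F) := Phi in
  (preauto_phi f v, preauto_phi f @` e, (val f : homeo S S) @` F).

(* An element of Aut acts through any preautomorphism representing it. *)
Definition flag_orbit (Phi : flag) : set flag :=
  [set Psi | exists a : Aut,
     exists2 f : preauto, Aut_class f = a & Psi = flag_act f Phi].

Definition flag_orbits : set (set flag) := flag_orbit @` [set Phi | is_flag Phi].

Definition face_boundary_cycle (F : set S) (c : seq V) : Prop :=
  [/\ (2 < size c)%N, uniq c, cycle (@adj V) c &
      frontier F =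
        i @` [set x | exists2 v, v \in c & edge_points R [set v; next c v] x]].

Definition schlafli_type (p q : nat) : Prop :=
  (forall v : V, [set w | adj v w] #= `I_q) /\
  (forall F, faces i F -> exists2 c, size c = p & face_boundary_cycle F c).

(* Flags are encoded as incident triples, so both notions carry the convention
   that every flag has exactly one j-adjacent flag for each j, and that the map
   has a Schlafli type with both entries finite. *)
Definition regular_map : Prop :=
  [/\ unique_adjacent_flags, exists p q, schlafli_type p q &
      flag_orbits #= `I_1].

Definition chiral_map : Prop :=
  [/\ unique_adjacent_flags, exists p q, schlafli_type p q,
      flag_orbits #= `I_2 &
      forall (j : 'I_3) Phi Psi, is_flag Phi -> is_flag Psi ->
        flag_adjacent j Phi Psi -> flag_orbit Phi <> flag_orbit Psi].

End Maps.

Section Ends.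
Context (X : topologicalType).

Definition end_sequence (U : nat -> set X) : Prop :=
  [/\ forall n, [/\ U n !=set0, connected (U n) & open (U n)],
      forall n, U n.+1 `<=` U n,
      forall n, compact (frontier (U n)),
      \bigcap_n closure (U n) = set0 &
      forall K : set X, compact K -> exists m, K `&` U m = set0].

Definition end_equiv (U U' : nat -> set X) : Prop :=
  (forall l, exists k, U' k `<=` U l) /\ (forall n, exists m, U m `<=` U' n).

Definition Ends : set (set (nat -> set X)) :=
  [set E | exists2 U, end_sequence U &
     E = [set U' | end_sequence U' /\ end_equiv U U']].

End Ends.
Arguments Ends X : clear implicits.

Section GroupEnds.
Context (G : groupType).
Local Open Scope group_scope.

Definition generates (A : set G) : Prop :=
  forall H : set G, H 1 -> (forall x y, H x -> H y -> H (x * y)) ->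
    (forall x, H x -> H x^-1) -> A `<=` H -> H = setT.

Definition finitely_generated : Prop :=
  exists2 A : set G, finite_set A & generates A.

Definition cayley_adj (A : set G) : rel G := fun x y =>
  (x != y) && `[< exists2 a, A a & y = x * a \/ x = y * a >].

Lemma cayley_sym A : symmetric (cayley_adj A).
Proof.
move=> x y; rewrite /cayley_adj eq_sym; congr (_ && _).
by apply/asboolP/asboolP => -[a Aa [->|->]]; exists a => //; auto.
Qed.

Lemma cayley_irrefl A : irreflexive (cayley_adj A).
Proof. by move=> x; rewrite /cayley_adj eqxx. Qed.

Definition cayley (A : set G) : sgraph :=
  SGraph (cayley_sym A) (cayley_irrefl A).

Definition group_Ends (R : realType) (A : set G) :
    set (set (nat -> set (realization R (cayley A)))) :=
  Ends (realization R (cayley A)).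

End GroupEnds.
Arguments group_Ends {G} R A.

(* Main.v *)
(** Only the identity fixes a flag, and each vertex, edge or face lies in finitely
    many flags, so an automorphism fixing a vertex, edge or face has finite order.
    Connectedness of the surface minus the vertices lets one walk from any flag to
    any other by adjacencies; hence [Aut M] is generated by finitely many torsion
    elements [t i] whose products [t i * t j] are torsion.

    Such a group [G] has at most one end, by a version of Serre's fixed point lemma
    for trees. Two ends would give an almost invariant subset of [G], that is, a
    finite cut with two infinite sides in the graph of cosets of the [<t i>].
    Uncrossing minimal cuts yields a cut [C] nested with all its translates. Each
    [t i] fixes the vertex [<t i>], so it either preserves a translate [D] of [C] or
    moves the side of [D] not containing this vertex off itself. If [t i] and [t j]
    did this on opposite sides of [D], then [t i * t j] would have infinite order;
    hence each [D] has a preferred side, the choice is [G]-invariant, and every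
    clique [{g <t i>}] meets the preferred side of [C]. The other side then
    contributes infinitely many boundary edges, a contradiction. *)

Require Import Defs.
From mathcomp Require Import all_boot all_order all_algebra finmap.
From mathcomp Require Import all_classical all_reals all_analysis.
From mathcomp Require Import lra.

Set Implicit Arguments.
Unset Strict Implicit.
Unset Printing Implicit Defensive.

Import Order.TTheory GRing.Theory Num.Theory.
Import numFieldNormedType.Exports.

Local Open Scope classical_set_scope.
Local Open Scope card_scope.

(** * Minimal cuts of a graph *)

Definition fcard (T : choiceType) (A : set T) : nat := #|` fset_set A|%fset.

Lemma fcard_sub (T : choiceType) (A B : set T) :
  finite_set B -> A `<=` B -> (fcard A <= fcard B)%N.
Proof.
move=> fB AB; apply: fsubset_leq_card.
by rewrite -fset_set_sub //; exact: sub_finite_set fB.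
Qed.

Lemma fcard_lt (T : choiceType) (A B : set T) x :
  finite_set B -> A `<=` B -> B x -> ~ A x -> (fcard A < fcard B)%N.
Proof.
move=> fB AB Bx nAx; have fA := sub_finite_set AB fB.
apply: fproper_ltn_card; rewrite fproperEneq; apply/andP; split; last first.
  by rewrite -fset_set_sub.
apply/eqP => /(congr1 (fun E => x \in E)).
by rewrite !in_fset_set // (mem_set Bx) => /set_mem.
Qed.

Lemma fcardUI (T : choiceType) (A B : set T) : finite_set A -> finite_set B ->
  (fcard (A `|` B) + fcard (A `&` B) = fcard A + fcard B)%N.
Proof.
by move=> fA fB; rewrite /fcard fset_setU // fset_setI // cardfsUI.
Qed.

(** Cardinals of two finite sets sum to those of their union and intersection, so two inclusions
    suffice. This serves for boundaries of corners; the strict variant that follows serves for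
    families of crossing cuts. *)
Lemma fcard_submodular (T : choiceType) (X Y Z W : set T) :
  finite_set X -> finite_set Y ->
  Z `|` W `<=` X `|` Y -> Z `&` W `<=` X `&` Y ->
  (fcard Z + fcard W <= fcard X + fcard Y)%N.
Proof.
move=> fX fY U I; have fU : finite_set (X `|` Y) by rewrite finite_setU.
have fZW := sub_finite_set U fU.
have [fZ fW] : finite_set Z /\ finite_set W by rewrite -finite_setU.
rewrite -(fcardUI fX fY) -(fcardUI fZ fW) leq_add //; first exact: fcard_sub.
by apply: fcard_sub I; exact: finite_setIl.
Qed.

Lemma fcard_submodular_lt (T : choiceType) (X Y Z W : set T) x :
  finite_set X -> finite_set Y ->
  Z `|` W `<=` X `|` Y -> Z `&` W `<=` X `&` Y ->
  (X `|` Y) x -> ~ (Z `|` W) x ->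
  (fcard Z + fcard W < fcard X + fcard Y)%N.
Proof.
move=> fX fY U I XYx ZWx; have fU : finite_set (X `|` Y) by rewrite finite_setU.
have fZW := sub_finite_set U fU.
have [fZ fW] : finite_set Z /\ finite_set W by rewrite -finite_setU.
rewrite -(fcardUI fX fY) -(fcardUI fZ fW) -addSn leq_add //; first exact: (@fcard_lt _ _ _ x).
by apply: fcard_sub I; exact: finite_setIl.
Qed.

Lemma fcard_bij (T U : choiceType) (f : T -> U) (g : U -> T) (A : set T) (B : set U) :
  cancel f g -> finite_set A -> finite_set B ->
  (forall x, A x <-> B (f x)) -> (forall y, B y -> f (g y) = y) ->
  fcard A = fcard B.
Proof.
move=> fK fA fB AB gK; apply/eqP.
have -> : B = f @` A.
  apply/seteqP; split=> [y By|_ [x Ax <-]]; last exact/AB.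
  by exists (g y); [apply/AB; rewrite gK | rewrite gK].
rewrite /fcard fset_set_image // card_imfset //; exact: can_inj fK.
Qed.

Lemma infinite_set_neq0 (T : Type) (A : set T) : infinite_set A -> exists x, A x.
Proof.
move=> iA; apply: contrapT => A0; apply: iA; apply: (@sub_finite_set _ _ set0) => //.
by move=> x Ax; apply: A0; exists x.
Qed.

(** * Bonds, cuts and nestedness in a quotient graph *)

Section Cuts.
Context (V : choiceType) (eqv : V -> V -> Prop).
Context (eqvS : forall u v, eqv u v -> eqv v u).
Implicit Types (adj : V -> V -> Prop) (C D E K : set V).

(* Sets saturated under [eqv] stand for sets of vertices of the quotient graph. *)
Definition saturated C := forall u v, eqv u v -> C u -> C v.

Definition boundary adj C : set (V * V) :=
  [set p | [/\ adj p.1 p.2, C p.1 & ~ C p.2]].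

(** Connectedness of the induced subgraph of the quotient, phrased as an induction principle instead
    of through paths; [joined] treats reachability in the same way. *)
Definition conn_set adj C := forall K, saturated K -> K `<=` C -> K !=set0 ->
  (forall u v, adj u v -> K u -> C v -> K v) -> C `<=` K.

Definition bond adj C :=
  [/\ saturated C, conn_set adj C & conn_set adj (~` C)].

Lemma saturatedC C : saturated C -> saturated (~` C).
Proof. by move=> sC u v /eqvS uv nCu Cv; apply: nCu; exact: sC Cv. Qed.

Lemma saturatedI C D : saturated C -> saturated D -> saturated (C `&` D).
Proof. by move=> sC sD u v uv [Cu Du]; split; [exact: sC Cu|exact: sD Du]. Qed.

Lemma saturatedU C D : saturated C -> saturated D -> saturated (C `|` D).
Proof. by move=> sC sD u v uv [Cu|Du]; [left; exact: sC Cu|right; exact: sD Du]. Qed.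

Definition joined adj x y := forall K, saturated K ->
  (forall u v, adj u v -> K u -> K v) -> K x -> K y.

(** The boundary is bounded by a covering list rather than by a cardinal: finiteness is built in,
    and deleting an edge removes one entry. *)
Definition separating adj k x y : set (set V) :=
  [set C | [/\ bond adj C, C x, ~ C y &
    exists2 s : seq (V * V), (size s <= k)%N & forall p, boundary adj C p -> p \in s]].

Lemma boundaryC adj (adjS : forall u v, adj u v -> adj v u) C p :
  boundary adj (~` C) p <-> boundary adj C (p.2, p.1).
Proof. by split=> -[] /adjS a b c; split=> //; exact: contrapT. Qed.

(* Deleting one edge of the boundary reduces [k]; if that disconnects the two
   ends of the edge, the bond is determined. *)
Lemma finite_separating k adj x y : (forall u v, adj u v -> adj v u) ->
  joined adj x y -> finite_set (separating adj k x y).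
Proof.
elim: k adj x y => [|k IHk] adj x y adjS xy.
  (* With an empty boundary, [C] is closed under adjacency and would contain [y]. *)
  apply: (@sub_finite_set _ _ set0) => // C [[sC _ _] Cx nCy [[|//] _ sP]].
  apply: nCy; apply: (xy C) => // u v uv Cu; apply: contrapT => nCv.
  by have /sP : boundary adj C (u, v).
have edge u v : adj u v -> finite_set (separating adj k.+1 u v).
  move=> uv; pose adj' a b := [/\ adj a b, (a, b) <> (u, v) & (a, b) <> (v, u)].
  have adj'S a b : adj' a b -> adj' b a.
    by case=> ab n1 n2; split; [exact: adjS|case=> *; subst..].
  (* A connection inside a set that misses [u] or [v] never uses the edge between them. *)
  have conn' C : conn_set adj C -> (~ C u \/ ~ C v) -> conn_set adj' C.
    move=> cC nC K sK KC K0 Kadj; apply: cC => // a b ab Ka Cb.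
    apply: (Kadj a) => //; have Ca := KC _ Ka.
    by split=> // -[aE bE]; subst; case: nC.
  have bond' C : bond adj C -> C u -> ~ C v -> bond adj' C.
    move=> [sC cC cC'] Cu nCv; split=> //; apply: conn' => //; first by right.
    by left=> /(_ Cu).
  have [j'|] := pselect (joined adj' u v).
    apply: sub_finite_set (IHk adj' u v adj'S j') => C [bC Cu nCv [s ss sP]].
    split=> //; first exact: bond'.
    have us : (u, v) \in s by apply: sP.
    exists (rem (u, v) s); first by rewrite size_rem // -subn1 leq_subLR.
    move=> p [[pa n1 n2] Cp nCp]; have ps : p \in s by exact: sP.
    have /(perm_mem) pE := perm_to_rem us.
    by move: ps; rewrite pE inE => /orP[/eqP pE'|//]; case: n1; rewrite -pE'; case: (p).
  move=> /existsNP[K /not_implyP[sK /not_implyP[Kadj /not_implyP[Ku nKv]]]].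
  apply: (@sub_finite_set _ _ [set K]) => [|//] C [bC Cu nCv _] /=.
  have [sC cC cC'] := bond' _ bC Cu nCv.
  (* [K] contains [u], misses [v] and is closed under the remaining edges. As both sides of [C] stay
     connected without the deleted edge, [C] can only be [K]. *)
  have CK : C `<=` C `&` K.
    apply: cC; [exact: saturatedI|by move=> ? []|by exists u|].
    by move=> a b ab [Ca Ka] Cb; split=> //; exact: Kadj Ka.
  have CK' : ~` C `<=` ~` C `&` ~` K.
    apply: cC'; [apply: saturatedI; exact: saturatedC|by move=> ? []|by exists v|].
    by move=> a b /adj'S ab [Ca nKa] Cb; split=> // Kb; apply: nKa; exact: Kadj Kb.
  apply/seteqP; split=> [a /CK[]//|a Ka]; apply: contrapT => /CK'[_]; exact.
(* Propagation from [x]: a set separating [x] from [v] separates [x] from [u] or [u] from [v]. *)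
pose K := [set z | finite_set (separating adj k.+1 x z)].
apply: (xy K).
- move=> u v uv; apply: sub_finite_set => C [bC Cx nCv H]; split=> //.
  by move=> Cu; apply: nCv; case: bC => sC _ _; exact: sC Cu.
- move=> u v uv Ku; have : finite_set (separating adj k.+1 x u `|` separating adj k.+1 u v).
    by rewrite finite_setU; split=> //; exact: edge.
  apply: sub_finite_set => C [bC Cx nCv H].
  by have [Cu|nCu] := pselect (C u); [right|left].
- apply: (@sub_finite_set _ _ set0) => // C [_ Cx nCx _]; exact: nCx.
Qed.

Definition nested C D := [\/ C `<=` D, D `<=` C, C `<=` ~` D | ~` C `<=` D].

Lemma nestedC C D : nested C D -> nested (~` C) D.
Proof.
case=> H; [constructor 4|constructor 3|constructor 2|constructor 1] => //.
- by rewrite setCK.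
- by move=> u nCu /H.
- by move=> u Du /H.
Qed.

Context (adj : V -> V -> Prop).
Context (adjS : forall u v, adj u v -> adj v u).
Context (adj_conn : forall x y, joined adj x y).

Definition cut C := [/\ saturated C, infinite_set C, infinite_set (~` C) &
  finite_set (boundary adj C)].

Definition mincut C :=
  cut C /\ forall D, cut D -> (fcard (boundary adj C) <= fcard (boundary adj D))%N.

Lemma finite_boundaryC C : finite_set (boundary adj C) -> finite_set (boundary adj (~` C)).
Proof.
move=> fC; have := finite_image (fun p : V * V => (p.2, p.1)) fC.
by apply: sub_finite_set => -[u v] /(boundaryC adjS) ?; exists (v, u).
Qed.

Lemma fcard_boundaryC C : finite_set (boundary adj C) ->
  fcard (boundary adj (~` C)) = fcard (boundary adj C).
Proof.
move=> fC; pose sw (p : V * V) := (p.2, p.1).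
have swK : cancel sw sw by case.
apply: (fcard_bij swK) => //; first exact: finite_boundaryC.
move=> p; exact: boundaryC.
Qed.

Lemma cutC C : cut C -> cut (~` C).
Proof.
case=> sC iC iC' fC; split; rewrite ?setCK //; first exact: saturatedC.
exact: finite_boundaryC.
Qed.

Lemma mincutC C : mincut C -> mincut (~` C).
Proof.
case=> cC mC; split=> [|D cD]; first exact: cutC.
by case: (cC) => _ _ _ fC; rewrite fcard_boundaryC //; exact: mC.
Qed.

Lemma exists_mincut C : cut C -> exists D, mincut D.
Proof.
have [n nE] : exists n, fcard (boundary adj C) = n by exists (fcard (boundary adj C)).
elim/ltn_ind: n C nE => n IHn C nE cC.
have [|/existsNP[D /not_implyP[cD /negP]]] :=
    pselect (forall D, cut D -> (fcard (boundary adj C) <= fcard (boundary adj D))%N).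
  by exists C.
by rewrite -ltnNge nE => /IHn; apply.
Qed.

Lemma boundary_neq0 C x y : saturated C -> C x -> ~ C y -> boundary adj C !=set0.
Proof.
move=> sC Cx nCy; apply: contrapT => b0; apply: nCy; apply: (@adj_conn x y C sC _ Cx) => u v uv Cu.
apply: contrapT => nCv; apply: b0; by exists (u, v).
Qed.

(** If [C] split into nonempty [K] and [L] without edges between them, both boundaries would be
    proper subsets of that of [C]. One of the two pieces is infinite, hence a strictly smaller
    cut. *)
Lemma mincut_conn C : mincut C -> conn_set adj C.
Proof.
move=> [[sC iC iC' fC] mC] K sK KC [x Kx] Kadj.
pose L := C `&` ~` K; have sL : saturated L by apply: saturatedI => //; exact: saturatedC.
have [y nCy] := infinite_set_neq0 iC'.
have bK : boundary adj K `<=` boundary adj C.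
  move=> [u v] [/= uv Ku nKv]; split=> //=; first exact: KC.
  by move=> Cv; apply: nKv; exact: Kadj Ku Cv.
have bL : boundary adj L `<=` boundary adj C.
  move=> [u v] [/= uv [Cu nKu] nLv]; split=> //= Cv; apply: nLv; split=> // Kv.
  by apply: nKu; apply: (Kadj v) => //; exact: adjS.
move=> z Cz; apply: contrapT => nKz.
have [[u v] buv] := boundary_neq0 sK Kx (fun Ky => nCy (KC _ Ky)).
have [[u' v'] buv'] := @boundary_neq0 L z y sL (conj Cz nKz) (fun Ly => nCy Ly.1).
have fin D : boundary adj D `<=` boundary adj C -> finite_set (boundary adj D).
  by move=> /sub_finite_set; apply.
have [fK|iK] := pselect (finite_set K).
  have cL : cut L.
    split=> //; last exact: fin.
      move=> fL; apply: iC; apply: (@sub_finite_set _ _ (K `|` L)).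
        by move=> a Ca; have [|] := pselect (K a); [left|right].
      by rewrite finite_setU.
    by apply: contra_not iC'; apply: sub_finite_set => a nCa [].
  have := mC _ cL; rewrite leqNgt => /negP; apply.
  apply: (@fcard_lt _ _ _ (u, v)) => //; first exact: bK.
  by case: buv => _ /= Ku _ [_ [_]].
have cK : cut K.
  split=> //; last exact: fin.
  by apply: contra_not iC'; apply: sub_finite_set => a nCa /KC.
have := mC _ cK; rewrite leqNgt => /negP; apply.
apply: (@fcard_lt _ _ _ (u', v')) => //; first exact: bL.
by case: buv' => _ /= [_ nKu] _ [].
Qed.

Lemma mincut_bond C : mincut C -> bond adj C.
Proof.
by move=> mC; split; [case: mC => -[]|exact: mincut_conn|apply: mincut_conn; exact: mincutC].
Qed.

(** * Crossing minimal cuts and uncrossing *)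

Definition crossing C : set (set V) := [set D | mincut D /\ ~ nested C D].

Lemma nested_sym C D : nested C D -> nested D C.
Proof.
case=> H; [constructor 2|constructor 1|constructor 3|constructor 4] => // u.
  by move=> Du /H.
by apply: contraPP => /H ?; exact.
Qed.

Lemma crossing_corners C D : ~ nested C D ->
  [/\ C `&` D !=set0, C `&` ~` D !=set0, ~` C `&` D !=set0 & ~` C `&` ~` D !=set0].
Proof.
move=> nCD; split; apply: contrapT => H; apply: nCD.
- by constructor 3 => u Cu Du; apply: H; exists u.
- by constructor 1 => u Cu; apply: contrapT => nDu; apply: H; exists u.
- by constructor 2 => u Du; apply: contrapT => nCu; apply: H; exists u.
- by constructor 4 => u nCu; apply: contrapT => nDu; apply: H; exists u.
Qed.

(* A crossing bond separates two endpoints of edges in the boundary of [C]. *)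
Lemma finite_crossing C : mincut C -> finite_set (crossing C).
Proof.
move=> mC; have [[sC iC iC' fC] _] := mC.
pose ends := (fst @` boundary adj C) `|` (snd @` boundary adj C).
have fE : finite_set ends by rewrite finite_setU; split; exact: finite_image.
pose k := fcard (boundary adj C).
apply: (@sub_finite_set _ _ (\bigcup_(p in ends `*` ends) separating adj k p.1 p.2)).
  (* A connected [E] with points on both sides of [C] must use an edge leaving [C]. *)
  have meets E : mincut E -> C `&` E !=set0 -> ~` C `&` E !=set0 -> ends `&` E !=set0.
    move=> mE [u [Cu Eu]] [v [nCv Ev]]; apply: contrapT => H.
    have [sE cE _] := mincut_bond mE.
    have : E `<=` C `&` E.
      apply: cE; [exact: saturatedI|by move=> ? []|by exists u|].
      move=> a b ab [Ca Ea] Eb; split=> //; apply: contrapT => nCb; apply: H.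
      by exists a; split=> //; left; exists (a, b).
    by move=> /(_ _ Ev)[].
  move=> D [mD /crossing_corners[CD CD' C'D C'D']].
  have [u [eu Du]] := meets _ mD CD C'D.
  have [v [ev nDv]] := meets _ (mincutC mD) CD' C'D'.
  exists (u, v) => //; split=> //; first exact: mincut_bond.
  have fD : finite_set (boundary adj D) by case: mD => -[].
  exists (fset_set (boundary adj D)).
    by case: mD => _ /(_ _ mC.1).
  by move=> p bp; rewrite in_fset_set //; exact: mem_set.
apply: bigcup_finite => [|p _]; first exact: finite_setX.
exact: finite_separating.
Qed.

Definition crossings C := fcard (crossing C).

Lemma boundary_submodular C D :
  boundary adj (C `&` D) `|` boundary adj (C `|` D) `<=` boundary adj C `|` boundary adj D /\
  boundary adj (C `&` D) `&` boundary adj (C `|` D) `<=` boundary adj C `&` boundary adj D.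
Proof.
split=> -[u v].
  case=> -[/= uv]; first case=> Cu Du nCDv.
    have [Cv|] := pselect (C v); last by left.
    by right; split=> //= Dv; exact: nCDv.
  by case=> [Cu|Du] nCDv; [left|right]; split=> //= ?; apply: nCDv; [left|right].
case=> -[/= uv [Cu Du] _] [_ _ nCDv].
by split; split=> //= ?; apply: nCDv; [left|right].
Qed.

(** Each corner is a cut, so its boundary has at least the minimal size, while submodularity bounds
    the sum of the two by twice that size. *)
Lemma mincut_corners C D : mincut C -> mincut D ->
  infinite_set (C `&` D) -> infinite_set (~` C `&` ~` D) ->
  mincut (C `&` D) /\ mincut (C `|` D).
Proof.
move=> mC mD iI iU; have [[sC _ _ fC] minC] := mC; have [[sD _ _ fD] minD] := mD.
have [subU subI] := boundary_submodular C D.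
have fU : finite_set (boundary adj C `|` boundary adj D) by rewrite finite_setU.
have cI : cut (C `&` D).
  split=> //; first exact: saturatedI.
    apply: contra_not iU; apply: sub_finite_set => a [nCa _] []; by move/nCa.
  by apply: sub_finite_set fU => a ?; apply: subU; left.
have cU : cut (C `|` D).
  split=> //; [exact: saturatedU| |by rewrite setCU|].
    by apply: contra_not iI; apply: sub_finite_set => a [Ca _]; left.
  by apply: sub_finite_set fU => a ?; apply: subU; right.
have le := fcard_submodular fC fD subU subI.
have CD : fcard (boundary adj C) = fcard (boundary adj D).
  by apply/eqP; rewrite eqn_leq (minC _ mD.1) (minD _ mC.1).
have := minC _ cI; have := minC _ cU; rewrite -CD in le => leU leI.
have eI : fcard (boundary adj (C `&` D)) = fcard (boundary adj C).
  apply/eqP; rewrite eqn_leq leI andbT.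
  by rewrite -(leq_add2r (fcard (boundary adj C))) (leq_trans _ le) // leq_add2l.
have eU : fcard (boundary adj (C `|` D)) = fcard (boundary adj C).
  apply/eqP; rewrite eqn_leq leU andbT.
  by rewrite -(leq_add2l (fcard (boundary adj C))) (leq_trans _ le) // leq_add2r.
by split; split=> // E cE; rewrite ?eI ?eU; exact: minC.
Qed.

(** The only bad cases are those where one of [C], [D] contains [E] and the other contains its
    complement; then [C] and [D] cover everything and are nested. *)
Lemma nested_cornerI C D E : nested C E -> nested D E -> ~ nested C D ->
  nested (C `&` D) E.
Proof.
move=> CE DE nCD; case: CE => CE.
- by constructor 1 => u [/CE].
- case: DE => DE.
  + by constructor 1 => u [_ /DE].
  + by constructor 2 => u Eu; split; [exact: CE|exact: DE].
  + by constructor 3 => u [_ /DE].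
  + by case: nCD; constructor 4 => u nCu; apply: contrapT => /DE /CE.
- by constructor 3 => u [/CE].
- case: DE => DE.
  + by constructor 1 => u [_ /DE].
  + case: nCD; constructor 4 => u /CE; exact: DE.
  + by constructor 3 => u [_ /DE].
  + constructor 4 => u nI; have [Cu|/CE//] := pselect (C u).
    by apply: DE => Du; apply: nI.
Qed.

Lemma nested_cornerU C D E : nested C E -> nested D E -> ~ nested C D ->
  nested (C `|` D) E.
Proof.
move=> /nestedC CE /nestedC DE nCD; rewrite -[_ `|` _]setCK; apply: nestedC.
rewrite setCU; apply: nested_cornerI => //.
by move=> /nestedC/nested_sym/nestedC/nested_sym; rewrite !setCK.
Qed.

Lemma nested_corner C D E : nested C E ->
  nested (C `&` D) E \/ nested (C `|` D) E.
Proof.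
case=> H.
- by left; constructor 1 => u [/H].
- by right; constructor 2 => u /H; left.
- by left; constructor 3 => u [/H].
- by right; constructor 4 => u nu; apply: H => Cu; apply: nu; left.
Qed.

(** A cut crossing one corner crosses [C] or [D], and a cut crossing both corners crosses both. The
    inequality is strict because [C] itself crosses [D] but neither corner. *)
Lemma crossings_corners C D : mincut C -> mincut D -> ~ nested C D ->
  infinite_set (C `&` D) -> infinite_set (~` C `&` ~` D) ->
  (crossings (C `&` D) + crossings (C `|` D) < crossings C + crossings D)%N.
Proof.
move=> mC mD nCD iI iU; have [mI mU] := mincut_corners mC mD iI iU.
apply: (@fcard_submodular_lt _ _ _ _ _ C); try exact: finite_crossing.
- move=> E [] [mE nE].
    have [CE|] := pselect (nested C E); last by left.
    by right; split=> // DE; apply: nE; exact: nested_cornerI.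
  have [CE|] := pselect (nested C E); last by left.
  by right; split=> // DE; apply: nE; exact: nested_cornerU.
- move=> E [[mE nI] [_ nU]]; split; split=> //.
    by move=> /(@nested_corner _ D)[].
  by move=> /(@nested_corner _ C); rewrite setIC setUC => -[].
- by right; split=> // /nested_sym.
- by move=> [] [_]; apply; [constructor 1 => u []|constructor 2; left].
Qed.

(** * Automorphisms, and a cut nested with all its translates *)

Record automorphism := Automorphism {
  auto_fun :> V -> V;
  auto_inv : V -> V;
  auto_funK : cancel auto_fun auto_inv;
  auto_invK : cancel auto_inv auto_fun;
  auto_adj : forall u v, adj (auto_fun u) (auto_fun v) <-> adj u v;
  auto_eqv : forall u v, eqv (auto_fun u) (auto_fun v) <-> eqv u v }.

Lemma automorphismV (t : automorphism) : {s : automorphism |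
  (forall x, s x = auto_inv t x) & forall x, auto_inv s x = t x}.
Proof.
case: t => f g fK gK fa fe /=.
have ga u v : adj (g u) (g v) <-> adj u v by rewrite -fa !gK.
have ge u v : eqv (g u) (g v) <-> eqv u v by rewrite -fe !gK.
by exists (Automorphism gK fK ga ge).
Qed.

Lemma cut_preimage (t : automorphism) C : cut C ->
  cut (t @^-1` C) /\ fcard (boundary adj (t @^-1` C)) = fcard (boundary adj C).
Proof.
case: t => f g fK gK fa fe /= [sC iC iC' fC].
have inf A : infinite_set A -> infinite_set (f @^-1` A).
  apply: contra_not => /(finite_image f); apply: sub_finite_set => a Aa.
  by exists (g a) => //=; rewrite gK.
have bE p : boundary adj (f @^-1` C) p <-> boundary adj C (f p.1, f p.2).
  by split=> -[/fa].
have ff : finite_set (boundary adj (f @^-1` C)).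
  have := finite_image (fun p : V * V => (g p.1, g p.2)) fC.
  by apply: sub_finite_set => -[u v] /bE ?; exists (f u, f v) => //=; rewrite !fK.
split.
  split=> //; [|exact: inf|exact: (inf (~` C))].
  by move=> u v uv; apply: sC; exact/fe.
apply: (@fcard_bij _ _ (fun p => (f p.1, f p.2)) (fun p => (g p.1, g p.2))) => //.
  by case=> u v /=; rewrite !fK.
by case=> u v /=; rewrite !gK.
Qed.

Lemma mincut_preimage (t : automorphism) C : mincut C -> mincut (t @^-1` C).
Proof.
move=> [cC mC]; have [ct e] := cut_preimage t cC; split=> // D cD; rewrite e; exact: mC.
Qed.

Lemma nested_preimage (t : automorphism) C D :
  nested (t @^-1` C) (t @^-1` D) <-> nested C D.
Proof.
have sub A B : t @^-1` A `<=` t @^-1` B <-> A `<=` B.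
  split=> [AB u|AB u /AB//]; rewrite -(auto_invK t u); exact: AB.
split.
  by case=> [/sub|/sub|/(sub C (~` D))|/(sub (~` C) D)] ?;
    [constructor 1|constructor 2|constructor 3|constructor 4].
case=> H; [constructor 1|constructor 2|constructor 3|constructor 4].
- exact/sub.
- exact/sub.
- exact/(sub C (~` D)).
- exact/(sub (~` C) D).
Qed.

Lemma crossings_preimage (t : automorphism) C : mincut C ->
  crossings (t @^-1` C) = crossings C.
Proof.
move=> mC; have [s sE sE'] := automorphismV t.
have tK : cancel (fun A : set V => t @^-1` A) (fun A => s @^-1` A).
  by move=> A; apply/seteqP; split=> u /=; rewrite sE auto_invK.
have sK : cancel (fun A : set V => s @^-1` A) (fun A => t @^-1` A).
  by move=> A; apply/seteqP; split=> u /=; rewrite sE auto_funK.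
apply/esym; apply: (fcard_bij tK); try exact: finite_crossing.
- exact/finite_crossing/mincut_preimage.
- move=> E; split=> -[mE nE]; split.
  + exact: mincut_preimage.
  + by move=> /nested_preimage.
  + by rewrite -(tK E); exact: mincut_preimage.
  + by move=> CE; apply: nE; exact/nested_preimage.
- by move=> E _; rewrite sK.
Qed.

Lemma crossingsC C : mincut C -> crossings (~` C) = crossings C.
Proof.
move=> mC; rewrite /crossings; congr fcard; apply/seteqP.
split=> D [mD nD]; split=> // /nestedC //.
by rewrite setCK.
Qed.

(* A translate crossing a minimal cut with the fewest crossings could be uncrossed,
   producing a minimal cut with fewer crossings. *)
Lemma exists_nested_cut C0 : cut C0 ->
  exists2 C, cut C & forall t : automorphism, nested C (t @^-1` C).
Proof.
move=> /exists_mincut[D0 mD0].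
have [C mC minC] : exists2 C, mincut C & forall D, mincut D -> (crossings C <= crossings D)%N.
  have [n nE] : exists n, crossings D0 = n by exists (crossings D0).
  elim/ltn_ind: n D0 nE mD0 => n IHn D nE mD.
  have [|/existsNP[E /not_implyP[mE /negP]]] :=
    pselect (forall E, mincut E -> (crossings D <= crossings E)%N); first by exists D.
  by rewrite -ltnNge nE => /IHn; apply.
exists C => [|t]; first by case: mC.
have uncross D E : mincut D -> mincut E -> crossings D = crossings C ->
    crossings E = crossings C -> infinite_set (D `&` E) ->
    infinite_set (~` D `&` ~` E) -> nested D E.
  move=> mD mE cD cE iI iU; apply: contrapT => nDE.
  have := crossings_corners mD mE nDE iI iU; rewrite cD cE ltnNge => /negP; apply.
  have [mI mU] := mincut_corners mD mE iI iU.
  by rewrite leq_add // minC.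
have mt := mincut_preimage t mC; set D := t @^-1` C in mt *.
have cD : crossings D = crossings C by exact: crossings_preimage.
have [iC iC'] : infinite_set C /\ infinite_set (~` C) by case: (mC) => -[].
have [iD iD'] : infinite_set D /\ infinite_set (~` D) by case: (mt) => -[].
have split_fin (A B : set V) : finite_set (A `&` B) -> finite_set (A `&` ~` B) -> finite_set A.
  by move=> f1 f2; rewrite -(setIT A) -(setUv B) setIUr finite_setU.
(* Uncrossing needs two opposite infinite corners. If one corner of this pair is finite, the other
   pair is infinite, and [C] is uncrossed with the complement of [D], which has the same number of
   crossings. *)
have [f1|i1] := pselect (finite_set (C `&` D)).
  have i2 : infinite_set (C `&` ~` D) by move=> /(split_fin _ _ f1).
  have i3 : infinite_set (~` C `&` D).
    by rewrite setIC in f1; rewrite setIC => f3; apply: iD; exact: split_fin f1 f3.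
  have : nested C (~` D).
    apply: uncross => //; [exact: mincutC|by rewrite crossingsC|by rewrite setCK].
  by move=> /nested_sym/nestedC; rewrite setCK => /nested_sym.
have [f4|i4] := pselect (finite_set (~` C `&` ~` D)); last exact: uncross.
have i2 : infinite_set (C `&` ~` D).
  by rewrite setIC => f2; apply: iD'; rewrite setIC in f4; exact: split_fin f2 f4.
have i3 : infinite_set (~` C `&` D).
  by move=> f3; apply: iC'; exact: split_fin f3 f4.
have : nested C (~` D).
  by apply: uncross => //; [exact: mincutC|rewrite crossingsC|rewrite setCK].
by move=> /nested_sym/nestedC; rewrite setCK => /nested_sym.
Qed.

End Cuts.

(** * Groups generated by torsion elements with torsion products *)

Definition torsion (G : groupType) (x : G) : Prop := exists n, (x ^+ n.+1 = 1)%g.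

Section TorsionGenerated.
Context (G : groupType) (I : finType) (t : I -> G).
Context (gen_t : generates (range t)).
Context (tor_t : forall i, torsion (t i)).
Context (tor_tt : forall i j, torsion (t i * t j)%g).
Local Open Scope group_scope.

(* Modulo [coset_rel] the pair [(g, i)] is the left coset of [<t i>] through
   [g]; two cosets are adjacent when they meet. *)
Let V : choiceType := (G * I)%type.
Let coset_rel (u v : V) : Prop :=
  u.2 = v.2 /\ (v.1 = u.1 * t u.2 \/ u.1 = v.1 * t v.2).
Let meet (u v : V) : Prop := u.1 = v.1.

Let coset_relS u v : coset_rel u v -> coset_rel v u.
Proof. by case=> e [H|H]; split=> //; [right|left]. Qed.

Let meetS u v : meet u v -> meet v u.
Proof. by []. Qed.

Lemma coset_sat (K : set V) x i : saturated coset_rel K -> K (x * t i, i) <-> K (x, i).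
Proof. by move=> sK; split; apply: sK; split=> //=; [right|left]. Qed.

(** The [h] whose right multiplication preserves membership in [K] form a subgroup. It contains
    [t i]: switching the index to [i] by [meet] makes this multiplication a move inside one
    coset. *)
Let meet_conn (u v : V) : joined coset_rel meet u v.
Proof.
move=> K sK Kmeet Ku.
have KE x i j : K (x, i) <-> K (x, j) by split; apply: Kmeet.
have H : [set h | forall x i, K (x * h, i) <-> K (x, i)] = setT.
  apply: gen_t.
  - by move=> x i; rewrite mulg1.
  - by move=> h k Hh Hk x i; rewrite mulgA Hk Hh.
  - by move=> h Hh x i; rewrite -(Hh (x * h^-1)) -mulgA mulVg mulg1.
  - by move=> _ [i _ <-] x j; rewrite (KE _ j i) (KE x j i) coset_sat.
case: u v Ku => [x i] [y j] Kx.
have : [set: G] (x^-1 * y) by [].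
by rewrite -H => /(_ x j); rewrite mulgA mulgV mul1g => ->; exact: (KE x i j).1.
Qed.

(** * Translates of a cut under the group *)

Let left_mul (h : G) : automorphism coset_rel meet.
Proof.
apply: (@Automorphism _ _ _ (fun u => (h * u.1, u.2)) (fun u => (h^-1 * u.1, u.2))).
- by case=> x i /=; rewrite mulgA mulVg mul1g.
- by case=> x i /=; rewrite mulgA mulgV mul1g.
- by move=> u v; split=> [/mulgI|->].
- move=> [x i] [y j]; rewrite /coset_rel /= -!mulgA.
  by split=> -[e H]; split=> //; case: H => [H|H]; [left|right|left|right];
    first [exact: mulgI H | rewrite H].
Defined.

(** This preimage is the translate of [D] by [h^-1], so the operation is a right action. *)
Local Notation "D ^/ h" := (left_mul h @^-1` D) (at level 30, h at level 29).

Lemma translate1 (D : set V) : D ^/ 1 = D.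
Proof. by apply/seteqP; split=> -[x i] /=; rewrite mul1g. Qed.

Lemma translateM (D : set V) h k : D ^/ (h * k) = (D ^/ h) ^/ k.
Proof. by apply/seteqP; split=> -[x i] /=; rewrite mulgA. Qed.

Lemma translate_inj h (D E : set V) : D ^/ h = E ^/ h -> D = E.
Proof. by move/(congr1 (fun F => F ^/ h^-1)); rewrite -!translateM mulgV !translate1. Qed.

(** Iterating the inclusion along the powers of [h] returns to [D], so no inclusion in the chain is
    strict. *)
Lemma torsion_translate_sub (D : set V) h : torsion h -> D `<=` D ^/ h -> D ^/ h = D.
Proof.
move=> [n hn] DDh; apply/seteqP; split=> //.
have sub m : D `<=` D ^/ (h ^+ m).
  elim: m => [|m IHm]; first by rewrite expg0 translate1.
  by rewrite expgSr translateM => u /DDh; exact: IHm.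
have : D ^/ h `<=` (D ^/ (h ^+ n)) ^/ h by move=> u; exact: sub.
by rewrite -translateM -expgSr hn translate1.
Qed.

(** The pair [(1, i)] represents the coset of the subgroup generated by [t i], a vertex that [t i]
    fixes. *)
Lemma translate_base (D : set V) i : saturated coset_rel D ->
  (D ^/ t i) (1, i) <-> D (1, i).
Proof. by move=> sD; rewrite -(coset_sat 1 i sD) /= mul1g mulg1. Qed.

(** An inclusion between [D] and its translate is an equality by torsion. In the other two cases the
    fixed vertex [(1, i)] belongs to both sets or to neither, which determines its side. *)
Lemma elliptic_trichotomy (D : set V) i : saturated coset_rel D ->
  nested D (D ^/ t i) ->
  [\/ D ^/ t i = D, ~ D (1, i) /\ D `<=` ~` (D ^/ t i) |
      D (1, i) /\ ~` D `<=` D ^/ t i].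
Proof.
move=> sD [H|H|H|H].
- by constructor 1; exact: torsion_translate_sub.
- constructor 1; apply: setC_inj; apply: (@torsion_translate_sub (~` D)) => //.
  exact: subsetC H.
- by constructor 2; split=> // Dx; apply: (H _ Dx); exact/translate_base.
- constructor 3; split=> //; apply: contrapT => nDx; apply: (nDx).
  exact/translate_base/H.
Qed.

(* Otherwise [t i * t j] would translate the complement of [D] properly into itself. *)
Lemma elliptic_same_side (D : set V) i j : saturated coset_rel D ->
  nested D (D ^/ t i) -> nested D (D ^/ t j) ->
  D ^/ t i <> D -> D ^/ t j <> D -> D (1, j) -> D (1, i).
Proof.
move=> sD /(elliptic_trichotomy sD) [//|[nDi Hi]|[]//].
move=> /(elliptic_trichotomy sD) [//|[]//|[_ Hj]] _ _ Dj.
have sub : D ^/ t j `<=` (~` D) ^/ (t i * t j) by move=> u /Hi; rewrite translateM.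
have : ~` D `<=` (~` D) ^/ (t i * t j) by move=> u /Hj/sub.
(* With equality, [sub] makes [D ^/ t j] disjoint from [D], although both contain [(1, j)]. *)
move=> /(torsion_translate_sub (tor_tt i j)) E; rewrite E in sub.
have /sub : (D ^/ t j) (1, j) by exact/translate_base.
by move=> /(_ Dj).
Qed.

(** [D] is the preferred side of its cut: it contains the fixed vertex of some generator that moves
    it. *)
Let facing (D : set V) := exists2 i, D ^/ t i <> D & D (1, i).

(** It is enough to pass from a translate [D] to [D ^/ t j] when [t j] moves [D]. By
    [elliptic_same_side], facing is then equivalent to containing [(1, j)], which both sets do or
    neither does. *)
Lemma facing_translate (C : set V) h : saturated coset_rel C ->
  (forall g, nested C (C ^/ g)) -> facing C -> facing (C ^/ h).
Proof.
move=> sC nC fC.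
have sCg g : saturated coset_rel (C ^/ g) by move=> u v uv; apply: sC; exact/auto_eqv.
have nCg g k : nested (C ^/ g) ((C ^/ g) ^/ k).
  have -> : (C ^/ g) ^/ k = (C ^/ (g * k * g^-1)) ^/ g.
    by rewrite -!translateM -!mulgA mulVg mulg1.
  exact/nested_preimage.
have : [set k | forall g, facing ((C ^/ g) ^/ k) <-> facing (C ^/ g)] h.
  rewrite (gen_t (H := [set k | _])) //.
  - by move=> g; rewrite translate1.
  - by move=> k l Hk Hl g; rewrite (translateM _ k l) -(translateM C g k) Hl translateM Hk.
  - by move=> k Hk g; rewrite -translateM -(Hk (g * k^-1)) -translateM -mulgA mulVg mulg1.
  - move=> _ [j _ <-] g.
    have [->//|nfix] := pselect ((C ^/ g) ^/ t j = C ^/ g).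
    have nfix' : ((C ^/ g) ^/ t j) ^/ t j <> (C ^/ g) ^/ t j by move/translate_inj.
    split=> -[i ni Di].
      exists j => //; apply/(translate_base j (sCg g)).
      rewrite -(translateM C g (t j)) in ni nfix' Di *.
      by apply: (@elliptic_same_side _ j i).
    exists j => //; apply/(translate_base j (sCg g)).
    exact: (@elliptic_same_side _ j i).
by move=> /(_ 1); rewrite translate1 => ->.
Qed.

(** If every translate is facing, each clique of pairs [(g, i)] with [g] fixed meets [C]. Every
    vertex outside [C] is then the end of a boundary edge, so there are finitely many. *)
Lemma nested_cut_not_facing (C : set V) : cut coset_rel meet C ->
  (forall g, nested C (C ^/ g)) -> ~ facing C.
Proof.
move=> [sC _ iC' fC] nC fsC; apply: iC'.
apply: sub_finite_set (finite_image snd fC) => -[g j] nCgj.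
have [i _ /= Ci] := facing_translate g sC nC fsC; rewrite mulg1 in Ci.
by exists ((g, i), (g, j)).
Qed.

(** If all generators fix [C], then [C] is invariant and every group element yields a boundary edge,
    forcing [G] to be finite. Otherwise some [t i] moves [C], and the side containing [(1, i)] is
    facing. *)
Lemma no_nested_cut (C : set V) : cut coset_rel meet C ->
  (forall g, nested C (C ^/ g)) -> False.
Proof.
move=> cC nC; have [sC iC iC' fC] := cC.
have [fix_all|/existsNP[i nfix]] := pselect (forall i, C ^/ t i = C).
  have fixG h : C ^/ h = C.
    have : [set k | C ^/ k = C] = setT.
      apply: gen_t => /=; first exact: translate1.
      - by move=> k l Hk Hl; rewrite translateM Hk Hl.
      - by move=> k Hk; rewrite -[in LHS]Hk -translateM mulgV translate1.
      - by move=> _ [i _ <-]; exact: fix_all.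
    by move=> E; have : [set: G] h by []; rewrite -E.
  have [[g i] Cgi] := infinite_set_neq0 iC.
  have [[k j] nCkj] := infinite_set_neq0 iC'.
  have fG : finite_set [set: G].
    apply: sub_finite_set (finite_image (fun p : V * V => p.1.1) fC) => x _.
    exists ((x, i), (x, j)) => //; split=> //=.
      by rewrite -(fixG (g * x^-1)) /= -mulgA mulVg mulg1.
    by rewrite -(fixG (k * x^-1)) /= -mulgA mulVg mulg1.
  apply: iC; apply: sub_finite_set (finite_setX fG (@finite_finset I setT)) => p //.
have [Ci|nCi] := pselect (C (1, i)).
  by apply: (nested_cut_not_facing cC nC); exists i.
apply: (@nested_cut_not_facing (~` C)); first exact: cutC.
  by move=> g; apply/nestedC/nested_sym/nestedC/nested_sym/nC.
by exists i => // /setC_inj.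
Qed.

Lemma almost_invariant_trivial (i0 : I) (B : set G) :
  (forall g, finite_set [set x | B x /\ ~ B (x * g)]) ->
  finite_set B \/ finite_set (~` B).
Proof.
move=> Binv; have [|iB] := pselect (finite_set B); first by left.
have [|iB'] := pselect (finite_set (~` B)); first by right.
(* [C] collects the cosets contained in [B]. *)
exfalso; pose C : set V := [set u | forall n, B (u.1 * t u.2 ^+ n)].
have sC : saturated coset_rel C.
  move=> [x i] [y j] [/= <- [->|->]] H n; rewrite /= in H *.
    by rewrite -mulgA -expgS.
  (* Here [t i ^+ N] is the inverse of [t i], which allows stepping backwards in the coset. *)
  have [N tN] := tor_t i; have := H (N + n)%N.
  by rewrite -mulgA -expgS -addSn expgnDr tN mul1g.
(* Only finitely many points of [B] lie in a coset leaving [B]: exponents matter modulo the order of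
   [t i], and each power loses finitely many points. *)
have fN i : finite_set [set x | B x /\ ~ C (x, i)].
  have [N tN] := tor_t i.
  apply: (@sub_finite_set _ _ (\bigcup_(m in `I_N.+1) [set x | B x /\ ~ B (x * t i ^+ m)])).
    move=> x [Bx /existsNP[m nB]]; exists (m %% N.+1)%N; first exact: ltn_pmod.
    split=> // H; apply: nB; rewrite /= (divn_eq m N.+1) addnC expgnDr mulnC expgnA tN.
    by rewrite expg1n mulg1.
  by apply: bigcup_finite => // m _; exact: Binv.
suff /(exists_nested_cut coset_relS meetS meet_conn)[D cD nD] : cut coset_rel meet C.
  by apply: (no_nested_cut cD) => g; exact: nD.
split=> //.
- move=> fC; apply: iB; have fU := finite_image fst fC.
  apply: (@sub_finite_set _ _ ((fst @` C) `|` [set x | B x /\ ~ C (x, i0)])).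
    move=> x Bx; have [Cx|nCx] := pselect (C (x, i0)); last by right.
    by left; exists (x, i0).
  by rewrite finite_setU; split.
- move=> /(finite_image fst) fC'; apply: iB'; apply: sub_finite_set fC' => x nBx.
  by exists (x, i0) => // /(_ 0%N); rewrite /= expg0 mulg1.
- apply: (@sub_finite_set _ _ (\bigcup_(p in [set: I * I])
     ((fun x => ((x, p.1), (x, p.2))) @` [set x | B x /\ ~ C (x, p.2)]))).
    move=> [[x i] [y j]] [/= xy Cx nCy]; rewrite /meet /= in xy; subst y.
    exists (i, j) => //=; exists x => //; split=> //.
    by have := Cx 0%N; rewrite /= expg0 mulg1.
  by apply: bigcup_finite => // p _; exact: finite_image.
Qed.

End TorsionGenerated.

(** * Ends of a locally finite graph *)

Section Realization.
Context (R : realType) (Gamma : sgraph).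
Context (lf : locally_finite Gamma).
Local Open Scope ring_scope.
Local Notation X := (realization R Gamma).
Local Notation vp := (@vertex_point R Gamma).

Lemma coordinate_continuous (w : Gamma) : continuous (fun x : X => (val x : {ptws Gamma -> R}) w).
Proof.
move=> x; apply: (@continuous_comp _ _ _ (fun x : X => (val x : {ptws Gamma -> R})) (fun f => f w)).
  exact: initial_continuous.
exact: (@proj_continuous Gamma (fun=> R) w).
Qed.

Definition link (u v : Gamma) := u = v \/ adj u v.

(** The parameter is clamped to the unit interval, so the map is total and continuous on all of
    [R]. *)
Definition edge_param u v (uv : link u v) (s : R) : X.
Proof.
pose t := Num.max 0 (Num.min 1 s).
apply: (@exist _ _ (fun w => (1 - t) * (w == u)%:R + t * (w == v)%:R)).
apply/mem_set; exists u, v; split=> //; exists t => //.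
by rewrite /t le_max lexx /= ge_max ler01 /= ge_min lexx.
Defined.

Lemma edge_param_continuous u v (uv : link u v) : continuous (edge_param uv).
Proof.
apply: continuous_comp_initial => s; apply/cvg_sup => w.
apply: (@continuous_comp_initial _ _ _ (fun f : {ptws Gamma -> R} => f w)) s => s /=.
have ct : {for s, continuous (fun s : R => Num.max 0 (Num.min 1 s) : R)}.
  apply: continuous_max; first exact: cvg_cst.
  by apply: continuous_min; [exact: cvg_cst|exact: cvg_id].
apply: cvgD; apply: cvgM; try exact: cvg_cst; last exact: ct.
by apply: cvgB; [exact: cvg_cst|exact: ct].
Qed.

Definition seg u v : set X := [set x | segment u v (val x)].

Lemma segE u v (uv : link u v) : seg u v = edge_param uv @` `[0, 1].
Proof.
apply/seteqP; split=> [x [t t01 xE]|_ [t t01 <-]].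
  exists t; first by rewrite /= in_itv.
  apply: val_inj; apply/funext => w /=; rewrite xE.
  by case/andP: t01 => t0 t1; rewrite (min_idPr t1) (max_idPr t0).
exists (Num.max 0 (Num.min 1 t)) => //.
by rewrite le_max lexx /= ge_max ler01 /= ge_min lexx.
Qed.

Lemma seg_compact u v : link u v -> compact (seg u v).
Proof.
move=> uv; rewrite (segE uv); apply: continuous_compact; last exact: segment_compact.
exact/continuous_subspaceT/edge_param_continuous.
Qed.

Lemma seg_connected u v : link u v -> connected (seg u v).
Proof.
move=> uv; rewrite (segE uv).
apply: connected_continuous_connected; first exact: segment_connected.
exact/continuous_subspaceT/edge_param_continuous.
Qed.

Lemma seg_vertexl u v : seg u v (vp u).
Proof.
by exists 0 => [|w]; rewrite ?lexx ?ler01 // subr0 mul1r mul0r addr0.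
Qed.

Lemma seg_vertexr u v : seg u v (vp v).
Proof.
by exists 1 => [|w]; rewrite ?lexx ?ler01 // subrr mul1r mul0r add0r.
Qed.

Lemma realizationP (x : X) : exists u v, link u v /\ seg u v x.
Proof. by case: x => x xP; have /set_mem := xP. Qed.

Lemma realization_support (x : X) : exists w, val x w != 0.
Proof.
have [u [v [_ [t _ xE]]]] := realizationP x.
have [t0|tn0] := eqVneq t 0.
  by exists u; rewrite xE t0 subr0 mul1r mul0r addr0 eqxx oner_eq0.
have [uv|uv] := eqVneq u v.
  by exists u; rewrite xE uv eqxx !mulr1 subrK oner_eq0.
by exists v; rewrite xE (eq_sym v) (negbTE uv) mulr0 add0r eqxx mulr1.
Qed.

Lemma seg_support u v x w : seg u v x -> val x w != 0 -> w = u \/ w = v.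
Proof.
move=> [t _ ->]; have [->|_] := eqVneq w u; first by left.
have [->|_] := eqVneq w v; first by right.
by rewrite !mulr0 addr0 eqxx.
Qed.

(** The open sets where one coordinate is nonzero cover [K]. Compactness is used in its
    near-covering form, along the filter generated by finite vertex sets growing upwards. *)
Lemma compact_finite_support (K : set X) : compact K ->
  exists2 D : set Gamma, finite_set D & forall x, K x -> exists2 w, D w & val x w != 0.
Proof.
move=> /compact_near_coveringP cK.
pose F : set_system (set Gamma) := [set S | exists2 D0, finite_set D0 &
  forall D, finite_set D -> D0 `<=` D -> S D].
have FF : Filter F.
  split; first by exists set0.
    move=> S T [D fD SD] [E fE TE]; exists (D `|` E); first by rewrite finite_setU.
    by move=> D' fD' DE; split; [apply: SD|apply: TE] => // u ?; apply: DE; [left|right].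
  by move=> S T ST [D fD SD]; exists D => // E fE DE; apply/ST/SD.
have [|D0 fD0 H] := cK _ F (fun D x => exists2 w, D w & val x w != 0) FF.
  move=> x Kx; have [w xw] := realization_support x.
  exists ([set y : X | val y w != 0], [set D | D w]); last by move=> [y D] [/= yw Dw]; exists w.
  split=> /=; last by exists [set w] => // D _; exact.
  apply: open_nbhs_nbhs; split=> //.
  apply: (@open_comp _ _ (fun y : X => (val y : {ptws Gamma -> R}) w) [set r | r != 0]).
    by move=> y _; exact: coordinate_continuous.
  exact: open_neq.
by exists D0 => // x Kx; apply: H.
Qed.

Lemma compact_finite_links (K : set X) : compact K ->
  finite_set [set p : Gamma * Gamma | link p.1 p.2 /\ (seg p.1 p.2 `&` K) !=set0].
Proof.
move=> /compact_finite_support[D fD HD].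
pose N w := [set v | link w v].
have fN w : finite_set (N w).
  apply: (@sub_finite_set _ _ ([set w] `|` [set v | adj w v])).
    by move=> v [->|?]; [left|right].
  by rewrite finite_setU.
apply: (@sub_finite_set _ _ (\bigcup_(w in D) (([set w] `*` N w) `|` (N w `*` [set w])))).
  move=> [u v] /= [uv [x [xs /HD[w Dw /(seg_support xs)[] wE]]]]; subst w.
    by exists u => //; left.
  by exists v => //; right; split=> //; case: uv => [->|uv]; [left|right; rewrite adj_sym].
apply: bigcup_finite => // w _; rewrite finite_setU; split; exact: finite_setX.
Qed.

(** * End sequences and finite edge cuts *)

Lemma connected_frontier_disjoint (T : topologicalType) (A U : set T) :
  open U -> connected A -> A `&` frontier U = set0 -> A `<=` U \/ A `&` U = set0.
Proof.
move=> oU cA AU; have [|/eqP AU0] := pselect (A `&` U = set0); first by right.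
left; have <- : A `&` U = A; last by move=> ? [].
apply: cA; [exact/set0P|by exists U|exists (closure U); first exact: closed_closure].
apply/seteqP; split=> x [Ax Ux]; split=> //; first exact: subset_closure.
apply: contrapT => nUx; suff : set0 x by [].
by rewrite -AU; split=> //; split=> // /interior_subset.
Qed.

Lemma end_sequence_subset (U : nat -> set X) m n : end_sequence U ->
  (m <= n)%N -> U n `<=` U m.
Proof.
move=> [_ dU _ _ _]; elim: n => [|n IHn]; first by rewrite leqn0 => /eqP ->.
rewrite leq_eqVlt => /orP[/eqP->//|]; rewrite ltnS => /IHn H x /dU; exact: H.
Qed.

(** If [Q] were finite, the segments in [E] and those starting in [Q] would form a compact set. The
    end sequence eventually leaves it, yet any later point lies on a segment starting in [Q]. *)
Lemma infinite_end_vertices (U : nat -> set X) (E : set (Gamma * Gamma)) (Q : set Gamma) n :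
  end_sequence U -> finite_set E -> E `<=` [set p | link p.1 p.2] ->
  (forall z u v, U n z -> link u v -> ~ E (u, v) -> seg u v z -> Q u) ->
  infinite_set Q.
Proof.
move=> eU fE linkE HQ fQ.
pose EQ := E `|` [set p | link p.1 p.2 /\ Q p.1].
have fEQ : finite_set EQ.
  rewrite finite_setU; split=> //.
  apply: (@sub_finite_set _ _ (\bigcup_(u in Q) ([set u] `*` ([set u] `|` [set v | adj u v])))).
    by move=> [u v] [/= uv Qu]; exists u => //; split=> //=; case: uv; [left|right].
  by apply: bigcup_finite => // u _; apply: finite_setX => //; rewrite finite_setU.
have cK : compact (\bigcup_(p in EQ) seg p.1 p.2).
  have -> : \bigcup_(p in EQ) seg p.1 p.2 = \bigcup_(p in [set` fset_set EQ]) seg p.1 p.2.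
    by rewrite fset_setK.
  rewrite bigcup_fset; rewrite big_seq; apply: (big_ind (@compact X)).
  - exact: compact0.
  - by move=> A B; exact: compactU.
  - move=> p; rewrite in_fset_set // => /set_mem[/linkE|[? _]]; exact: seg_compact.
have [ne dU _ _ /(_ _ cK)[m Km]] := eU.
have [[z Uz] _ _] := ne (maxn m n).
have Umz := end_sequence_subset eU (leq_maxl m n) Uz.
have Unz := end_sequence_subset eU (leq_maxr m n) Uz.
have [u [v [uv zs]]] := realizationP z.
have nEQ : ~ EQ (u, v) by move=> H; have : set0 z by rewrite -Km; split=> //; exists (u, v).
apply: (nEQ); right; split=> //; apply: (HQ z u v) => // H; apply: nEQ; by left.
Qed.

(** Late sets of [U'] miss the compact frontier of [U l], hence miss [U l]. The vertices in [U l]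
    form [B], since an edge leaving [B] crosses that frontier and only finitely many segments do. *)
Lemma separated_ends_cut (U U' : nat -> set X) l :
  end_sequence U -> end_sequence U' -> (forall k, ~ U' k `<=` U l) ->
  exists B : set Gamma, [/\ infinite_set B, infinite_set (~` B) &
    finite_set [set p : Gamma * Gamma | [/\ adj p.1 p.2, B p.1 & ~ B p.2]]].
Proof.
move=> eU eU' nsub; have [ne dU fr _ _] := eU; have [_ _ oUl] := ne l.
have [ne' _ _ _ /(_ _ (fr l))[m Um]] := eU'.
have disj : U' m `&` U l = set0.
  have [_ cU' _] := ne' m.
  have [||//] := connected_frontier_disjoint oUl cU'; first by rewrite setIC.
  by move/nsub.
pose E := [set p : Gamma * Gamma | link p.1 p.2 /\ (seg p.1 p.2 `&` frontier (U l)) !=set0].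
have fE : finite_set E by exact: compact_finite_links.
have linkE : E `<=` [set p | link p.1 p.2] by move=> p [].
have side u v : link u v -> ~ E (u, v) -> seg u v `<=` U l \/ seg u v `&` U l = set0.
  move=> uv nE; apply: connected_frontier_disjoint => //; first exact: seg_connected.
  by apply: contrapT => /eqP/set0P H; apply: nE.
exists [set v | U l (vp v)]; split.
- apply: (infinite_end_vertices (n := l) eU fE linkE) => z u v Uz uv nE zs.
  case: (side _ _ uv nE) => [|H]; first by apply; exact: seg_vertexl.
  by have : set0 z by rewrite -H.
- apply: (infinite_end_vertices (n := m) eU' fE linkE) => z u v Uz uv nE zs /= Uu.
  case: (side _ _ uv nE) => [|H].
    by move=> /(_ _ zs) Ulz; have : set0 z by rewrite -disj.
  have : set0 (vp u) by rewrite -H; split=> //; exact: seg_vertexl.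
  by [].
- apply: sub_finite_set fE => -[u v] [/= uv Uu nUv]; apply: contrapT => nE.
  have luv : link u v by right.
  case: (side _ _ luv nE) => [|H]; first by move/(_ _ (seg_vertexr u v)).
  have : set0 (vp u) by rewrite -H; split=> //; exact: seg_vertexl.
  by [].
Qed.

Lemma card_ends_le1 :
  (forall B : set Gamma,
    finite_set [set p : Gamma * Gamma | [/\ adj p.1 p.2, B p.1 & ~ B p.2]] ->
    finite_set B \/ finite_set (~` B)) ->
  Ends X #= `I_0 \/ Ends X #= `I_1.
Proof.
move=> noB.
have sub (U U' : nat -> set X) : end_sequence U -> end_sequence U' ->
    forall l, exists k, U' k `<=` U l.
  move=> eU eU' l; apply: contrapT => /forallNP nsub.
  have [B [iB iB' fB]] := separated_ends_cut eU eU' nsub.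
  by case: (noB B fB).
have [[E0 HE0]|E0] := pselect (exists E, Ends X E); last first.
  left; rewrite II0; have -> : Ends X = set0; last exact: card_eq00.
  by apply/seteqP; split=> // E HE; apply: E0; exists E.
right; have -> : Ends X = [set E0]; last exact: card_set1.
have [U eU E0E] := HE0.
apply/seteqP; split=> [E [U' eU' ->]|_ -> //].
rewrite E0E /=; apply/seteqP; split=> W [eW _]; split=> //; split; exact: sub.
Qed.

End Realization.

(** A finite edge boundary makes [B] almost invariant under generators and their inverses. The
    elements [g] for which this holds for both [g] and [g^-1] form a subgroup. *)
Lemma ends_almost_invariant (R : realType) (G : groupType) (A : set G) :
  finite_set A -> generates A ->
  (forall B : set G, (forall g : G, finite_set [set x | B x /\ ~ B (x * g)%g]) ->
     finite_set B \/ finite_set (~` B)) ->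
  group_Ends R A #= `I_0 \/ group_Ends R A #= `I_1.
Proof.
move=> fA genA noB; apply: card_ends_le1.
  move=> g; apply: (@sub_finite_set _ _
    ((fun a => g * a)%g @` A `|` (fun a => g * a^-1)%g @` A)).
    move=> h /andP[_ /asboolP[a Aa [->|->]]]; first by left; exists a.
    by right; exists a => //; rewrite -mulgA mulgV mulg1.
  by rewrite finite_setU; split; exact: finite_image.
move=> B fB; apply: noB.
have step (a : G) : A a -> finite_set [set x | B x /\ ~ B (x * a)%g] /\
    finite_set [set x | B x /\ ~ B (x * a^-1)%g].
  move=> Aa; have adjI (x y : G) : B x -> ~ B y -> y = (x * a)%g \/ x = (y * a)%g ->
      @adj (cayley A) x y.
    move=> Bx nBy xy; apply/andP; split; last by apply/asboolP; exists a.
    by apply/eqP => xE; apply: nBy; rewrite -xE.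
  split; apply: sub_finite_set (finite_image fst fB) => x [Bx nBx].
    by exists (x, x * a)%g => //; split=> //=; apply: adjI => //; left.
  exists (x, x * a^-1)%g => //; split=> //=; apply: adjI => //; right.
  by rewrite -mulgA mulVg mulg1.
pose fin g := finite_set [set x | B x /\ ~ B (x * g)%g].
have mulfin g h : fin g -> fin h -> fin (g * h)%g.
  move=> fg fh; apply: (@sub_finite_set _ _ ([set x | B x /\ ~ B (x * g)%g] `|`
      (fun x => x * g^-1)%g @` [set x | B x /\ ~ B (x * h)%g])).
    move=> x [Bx nB]; have [Bg|] := pselect (B (x * g)%g); last by left.
    right; exists (x * g)%g; last by rewrite -mulgA mulgV mulg1.
    by split=> //=; rewrite -mulgA.
  by rewrite finite_setU; split=> //; exact: finite_image.
have : [set g | fin g /\ fin (g^-1)%g] = setT.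
  apply: genA => /=.
  - by rewrite invg1 /fin; split;
      apply: (@sub_finite_set _ _ set0) => // x; rewrite /= mulg1 => -[].
  - by move=> g h [? ?] [? ?]; rewrite invgM; split; exact: mulfin.
  - by move=> g []; rewrite invgK.
  - exact: step.
by move=> H g; have : [set: G] g by []; rewrite -H => -[].
Qed.

(** * Punctured neighborhoods in a surface *)

Section PlaneSquares.
Context (R : realType).
Local Open Scope ring_scope.

Lemma connected_setX (A B : set R) : connected A -> connected B -> connected (A `*` B).
Proof.
move=> cA cB; have [[[a0 b0] [/= Aa0 Bb0]]|AB0] := pselect ((A `*` B) !=set0); last first.
  have -> : A `*` B = set0 by apply/seteqP; split=> // z ABz; case: AB0; exists z.
  exact: connected0.
have -> : A `*` B = \bigcup_(b in B) ((fun a => (a, b)) @` A `|` (fun b => (a0, b)) @` B).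
  apply/seteqP; split=> [[a b] [/= Aa Bb]|z [b Bb []]].
  - by exists b => //; left; exists a.
  - by move=> [a Aa <-].
  - by move=> [b' Bb' <-].
apply: bigcup_connected; first by exists (a0, b0) => b Bb; right; exists b0.
move=> b Bb; apply: connectedU.
- by exists (a0, b); split; [exists a0|exists b].
- apply: connected_continuous_connected => //; apply: continuous_subspaceT => a.
  by apply: (@cvg_pair _ _ _ (nbhs a) (nbhs a) (nbhs b)); [exact: cvg_id|exact: cvg_cst].
- apply: connected_continuous_connected => //; apply: continuous_subspaceT => a.
  by apply: (@cvg_pair _ _ _ (nbhs a) (nbhs a0) (nbhs a)); [exact: cvg_cst|exact: cvg_id].
Qed.

(** The punctured square is covered by four open rectangles (left, top, right, bottom); the overlaps
    used are the three corner points given as witnesses. *)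
Lemma connected_punctured_square (y : R * R) (e : R) : 0 < e ->
  connected (ball y e `\ y).
Proof.
case: y => a b e0; pose box (i j : interval R) := [set` i] `*` [set` j].
have cbox i j : connected (box i j).
  by apply: connected_setX; apply/connected_intervalP; exact: interval_is_interval.
pose I := `]a - e, a + e[; pose J := `]b - e, b + e[.
have -> : ball (a, b) e `\ (a, b) =
    ((box `]a - e, a[ J `|` box I `]b, b + e[) `|` box `]a, a + e[ J) `|` box I `]b - e, b[.
  have ballE (c x : R) : ball c e x <-> c - e < x < c + e.
    by rewrite -ball_normE /ball_ /= distrC ltr_distl.
  apply/seteqP; split=> -[x y].
    case=> -[/= /ballE /andP[x1 x2] /ballE /andP[y1 y2]] n.
    rewrite /box /I /J /setX /=; rewrite !in_itv /= x1 x2 y1 y2 !andbT /=.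
    have [xa|xa|xa] := ltgtP x a; [by do 3 left|by left; right|subst x].
    by have [yb|yb|yb] := ltgtP y b; [right|left; left; right|subst y].
  rewrite /box /I /J /setX /= !in_itv /= => H.
  have {}H : [/\ a - e < x < a + e, b - e < y < b + e & x != a \/ y != b].
    case: H => [[[|]|]|] [/andP[x1 x2] /andP[y1 y2]]; split; lra.
  case: H => /ballE ? /ballE ? n; split; first by split.
  by case=> xa yb; subst; case: n => /eqP.
apply: connectedU (cbox _ _).
  exists (a - e / 2, b - e / 2); rewrite /box /I /J /setX /= !in_itv /=.
  by split; [do 2 left|]; split; apply/andP; split; lra.
apply: connectedU (cbox _ _).
  exists (a + e / 2, b + e / 2); rewrite /box /I /J /setX /= !in_itv /=.
  by split; [right|]; split; apply/andP; split; lra.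
apply: connectedU (cbox _ _) (cbox _ _).
exists (a - e / 2, b + e / 2); rewrite /box /I /J /setX /= !in_itv /=.
by split; split; apply/andP; split; lra.
Qed.

Lemma connected_square (y : R * R) (e : R) : connected (ball y e).
Proof.
case: y => a b; have ballI (c : R) : connected (ball c e).
  by apply/connected_intervalP; rewrite ball_itv; exact: interval_is_interval.
exact: (connected_setX (ballI a) (ballI b)).
Qed.

Lemma punctured_neighborhood (S : topologicalType) (x : S) (W : set S) :
  locally_euclidean2 R S -> open W -> W x ->
  exists N : set S, [/\ open N, N x, N `<=` W, connected N & connected (N `\ x)].
Proof.
move=> /(_ x) [U [W0 [oU Ux oW0 [h]]]] oW Wx.
pose x' : set_type U := exist _ x (mem_set Ux).
pose y : R * R := val (h x').
have W0y : W0 y by have /set_mem := valP (h x').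
(* The inverse chart, with default value [x] off [W0]; it is only evaluated on a ball inside
   [W0]. *)
pose phi : R * R -> S := valL_ x (fun w : set_type W0 => val (homeo_inv h w)).
have phiE (w : set_type W0) : phi (val w) = val (homeo_inv h w).
  by rewrite /phi; have /(congr1 (@^~ w)) := valLK x (fun w : set_type W0 => val (homeo_inv h w)).
have cphi : {within W0, continuous phi}.
  apply/subspace_valL_continuousP' => w.
  apply: (@continuous_comp _ _ _ (homeo_inv h) (fun u : set_type U => val u)).
    exact: homeo_inv_cont.
  exact: initial_continuous.
have oP : open ((fun w : set_type W0 => val (homeo_inv h w)) @^-1` W).
  apply: open_comp => // w _.
  apply: (@continuous_comp _ _ _ (homeo_inv h) (fun u : set_type U => val u)).
    exact: homeo_inv_cont.
  exact: initial_continuous.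
have [Z oZ ZE] := oP.
have Zy : Z y.
  have : (val @^-1` Z) (h x') by rewrite ZE /= homeo_funK.
  by [].
have /nbhs_ballP[e /= e0 eZ] : nbhs y (Z `&` W0) by apply: open_nbhs_nbhs; split=> //; exact: openI.
have sW0 : ball y e `<=` W0 by move=> z /eZ[].
have phiy : phi y = x by rewrite /y phiE homeo_funK.
have phi_inj z : ball y e z -> phi z = x -> z = y.
  move=> /sW0 W0z; have -> : z = val (exist _ z (mem_set W0z) : set_type W0) by [].
  rewrite phiE => E; rewrite /y; congr val.
  by rewrite -[LHS](homeo_invK h); congr (homeo_fun h _); apply: val_inj.
have conn A : A `<=` ball y e -> connected A -> connected (phi @` A).
  move=> Ae cA; apply: connected_continuous_connected => //.
  by apply: continuous_subspaceW cphi => z /Ae /sW0.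
exists (phi @` ball y e); split.
- have : open ((fun u : set_type U => val (h u)) @^-1` ball y e).
    apply: open_comp => [u _|]; last exact: ball_open.
    apply: (@continuous_comp _ _ _ (homeo_fun h) (fun u : set_type W0 => val u)).
      exact: homeo_fun_cont.
    exact: initial_continuous.
  move=> [Q oQ QE]; have -> : phi @` ball y e = U `&` Q; last exact: openI.
  apply/seteqP; split=> [_ [z yez <-]|s [Us Qs]].
    have /sW0 W0z := yez; pose w : set_type W0 := exist _ z (mem_set W0z).
    have -> : z = val w by []; rewrite phiE; split; first by have /set_mem := valP (homeo_inv h w).
    have : (val @^-1` Q) (homeo_inv h w) by rewrite QE /= homeo_invK.
    by [].
  pose u : set_type U := exist _ s (mem_set Us).
  have : (val @^-1` Q) u by [].
  by rewrite QE => ?; exists (val (h u)) => //; rewrite phiE homeo_funK.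
- by exists y => //; exact: ballxx.
- move=> _ [z yez <-]; have [Zz W0z] := eZ _ yez.
  pose w : set_type W0 := exist _ z (mem_set W0z).
  have : (val @^-1` Z) w by [].
  by rewrite ZE => Hw; have -> : z = val w by []; rewrite phiE.
- by apply: conn => //; exact: connected_square.
- have -> : phi @` ball y e `\ x = phi @` (ball y e `\ y).
    apply/seteqP; split=> [_ [[z yez <-] n]|_ [z [yez n] <-]].
      by exists z => //; split=> // zy; apply: n; rewrite zy.
    by split; [exists z|move=> /(phi_inj _ yez)].
  by apply: conn; [move=> ? []|exact: connected_punctured_square].
Qed.

End PlaneSquares.

(** * Connectivity of the flags of a map *)

(** Rotating the cycle to start at [a] turns the claim into induction on the position. *)
Lemma next_ind (T : eqType) (c : seq T) (P : T -> Prop) (a : T) : uniq c -> a \in c ->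
  P a -> (forall v, v \in c -> P v -> P (next c v)) -> forall v, v \in c -> P v.
Proof.
move=> uc ac Pa step; have [k s rE] := rot_to ac.
have us : uniq (a :: s) by rewrite -rE rot_uniq.
have nextE v : next c v = next (a :: s) v by rewrite -rE next_rot.
have memE v : (v \in c) = (v \in a :: s) by rewrite -rE mem_rot.
have H n : (n < size (a :: s))%N -> P (nth a (a :: s) n).
  elim: n => [//|n IHn] ns; have n_lt := ltnW ns.
  have nin : nth a (a :: s) n \in c by rewrite memE mem_nth.
  by have := step _ nin (IHn n_lt); rewrite nextE next_nth mem_nth // index_uniq.
by move=> v; rewrite memE => /(nthP a)[n ns <-]; exact: H.
Qed.

Lemma next_next_neq (T : eqType) (c : seq T) (v : T) : uniq c -> (2 < size c)%N ->
  v \in c -> next c (next c v) != v.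
Proof.
move=> uc c2 vc; have [k s rE] := rot_to vc.
rewrite -!(next_rot k uc) rE; move: (uc) c2; rewrite -(rot_uniq k) -(size_rot k) rE.
case: s {rE} => [//|b [//|d s]] /= /andP[]; rewrite !inE !negb_or => /and3P[vb vd vs] _ _.
by rewrite eqxx [b == v]eq_sym (negbTE vb) eqxx eq_sym.
Qed.

(** * Open edges of the realization *)

Section RealizationEdges.
Context (R : realType) (Gamma : sgraph).
Local Open Scope ring_scope.
Local Notation X := (realization R Gamma).

Lemma adj_neq (u v : Gamma) : adj u v -> u <> v.
Proof. by move=> uv uE; move: uv; rewrite uE adj_irrefl. Qed.

Definition open_edge (e : set Gamma) : set X := [set x | forall w, val x w != 0 <-> e w].

Lemma open_edge_nonempty e : is_edge e -> open_edge e !=set0.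
Proof.
move=> [u [v [uv ->]]]; have luv : link u v by right.
exists (edge_param luv (1 / 2)) => w /=.
have h : 1 / 2 <= (1 : R) by lra.
rewrite (min_idPr h) (max_idPr _); last lra.
have uv' := adj_neq uv; split.
  have [->|_] := eqVneq w u; first by left.
  have [->|_] := eqVneq w v; first by right.
  by rewrite !mulr0 addr0 eqxx.
case=> ->; rewrite eqxx; [have /eqP/negbTE -> := uv'|have /nesym/eqP/negbTE -> := uv'] => /=; lra.
Qed.

Lemma realization_cases (x : X) :
  (exists v, x = vertex_point R v) \/ exists2 e, is_edge e & open_edge e x.
Proof.
have [u [v [uv [t t01 xE]]]] := realizationP x.
have vertex (w : Gamma) : (forall z, val x z = (z == w)%:R) -> exists v, x = vertex_point R v.
  by move=> H; exists w; apply: val_inj; apply/funext => z /=; rewrite H.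
have [t0|tn0] := eqVneq t 0; [|have [t1|tn1] := eqVneq t 1].
- by left; apply: (vertex u) => z; rewrite xE t0 subr0 mul1r mul0r addr0.
- by left; apply: (vertex v) => z; rewrite xE t1 subrr mul1r mul0r add0r.
case: uv => [uv|uv].
  by left; apply: (vertex v) => z; rewrite xE uv -mulrDl subrK mul1r.
right; exists [set u; v]; first by exists u, v.
move=> w; rewrite xE; split.
  have [->|_] := eqVneq w u; first by left.
  have [->|_] := eqVneq w v; first by right.
  by rewrite !mulr0 addr0 eqxx.
have uv' := adj_neq uv.
case=> ->; rewrite eqxx.
  by have /eqP/negbTE -> := uv'; rewrite mulr0 addr0 mulr1 subr_eq0 eq_sym.
by have /nesym/eqP/negbTE -> := uv'; rewrite mulr0 add0r mulr1.
Qed.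

Lemma vertex_not_open_edge v e : is_edge e -> ~ open_edge e (vertex_point R v).
Proof.
move=> [a [b [ab ->]]] H; apply: (adj_neq ab).
have supp w : [set a; b] w -> w = v.
  by move=> /H /=; case: (eqVneq w v) => // _; rewrite eqxx.
by rewrite (supp a (or_introl erefl)) (supp b (or_intror erefl)).
Qed.

Lemma edge_sub_eq (e e' : set Gamma) : is_edge e -> is_edge e' -> e `<=` e' -> e = e'.
Proof.
move=> [a [b [ab ->]]] [c [d [cd ->]]] sub; have ab' := adj_neq ab.
apply/seteqP; split=> // w.
by case: (sub a (or_introl erefl)) (sub b (or_intror erefl)) => [] aE [] bE [] ->;
  rewrite ?aE ?bE; try (by left); try (by right); case: ab'; rewrite aE bE.
Qed.

Lemma open_edge_eq e e' x : open_edge e x -> open_edge e' x -> e = e'.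
Proof. by move=> H H'; apply/seteqP; split=> w; [rewrite -H H'|rewrite -H' H]. Qed.

Lemma open_support (w : Gamma) : open [set x : X | val x w != 0].
Proof.
apply: (@open_comp _ _ (fun y : X => (val y : {ptws Gamma -> R}) w) [set r | r != 0]).
  by move=> y _; exact: coordinate_continuous.
exact: open_neq.
Qed.

(** A support has at most two vertices, so being nonzero at both endpoints, an open condition,
    already forces it to be [e]. *)
Lemma open_edge_open e : is_edge e -> open (open_edge e).
Proof.
move=> he; have [a [b [ab eE]]] := he.
have -> : open_edge e = [set x | val x a != 0] `&` [set x | val x b != 0].
  apply/seteqP; split=> [x H|x [xa xb]].
    by split; apply/H; rewrite eE; [left|right].
  have [[v xv]|[e' he' xe']] := realization_cases x.
    move: xa xb; rewrite xv /=; case: (eqVneq a v) => [aE|_]; last by rewrite eqxx.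
    by case: (eqVneq b v) => [bE|_]; [case: (adj_neq ab); rewrite aE bE|rewrite eqxx].
  have -> : e = e'; last by [].
  by apply: edge_sub_eq => // w; rewrite eE => -[] ->; apply/xe'.
by apply: openI; exact: open_support.
Qed.

End RealizationEdges.

Lemma interior_witness (T : topologicalType) (A N : set T) x :
  open N -> N x -> N `<=` A -> A° x.
Proof. by move=> oN Nx NA; apply: filterS NA _; exact: open_nbhs_nbhs. Qed.

Lemma connected_open_pair (T : topologicalType) (C P Q : set T) : connected C ->
  open P -> open Q -> P `&` Q = set0 -> C `<=` P `|` Q -> C `<=` P \/ C `<=` Q.
Proof.
move=> cC oP oQ PQ CPQ; have nPQ u : P u -> Q u -> False.
  by move=> Pu Qu; have : set0 u by rewrite -PQ.
have [|/eqP/set0P CP] := pselect (C `&` P = set0).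
  move=> CP0; right=> u Cu; case: (CPQ u Cu) => // Pu.
  by have : set0 u by rewrite -CP0.
left; have <- : C `&` P = C; last by move=> ? [].
apply: cC => //; first by exists P.
exists (~` Q); first exact: open_closedC.
by apply/seteqP; split=> u [Cu H]; split=> //; [move=> /(nPQ u H)|case: (CPQ u Cu)].
Qed.

(** * Walking from flag to flag on the surface *)

Section FlagConnectivity.
Context (R : realType) (M : surface_map R).
Local Notation S := (surf M).
Local Notation V := (graph M).
Local Notation i := (@emb R M).
Local Notation open_edge := (@open_edge R V).

Context (p q : nat).
Context (hpq : schlafli_type M p q).

Let face_cycle (F : set S) : faces i F -> exists c, face_boundary_cycle F c.
Proof. by move=> /(proj2 hpq)[c _ cF]; exists c. Qed.

Let i_inj : injective i. Proof. exact: (embP M).1. Qed.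

Lemma face_sub (F : set S) : faces i F -> F `<=` ~` range i.
Proof. by move=> [x _ ->]; exact: connected_component_sub. Qed.

Lemma face_meet_eq (F F' : set S) x : faces i F -> faces i F' -> F x -> F' x -> F = F'.
Proof.
move=> [y _ ->] [z _ ->] /same_connected_component -> /same_connected_component ->.
by [].
Qed.

Lemma face_exists (x : S) : ~ range i x -> exists2 F, faces i F & F x.
Proof.
move=> nx; exists (connected_component (~` range i) x); first by exists x.
exact: connected_component_refl.
Qed.

(* A face is disjoint from its frontier, which lies in the graph. *)
Lemma face_open (F : set S) : faces i F -> open F.
Proof.
move=> hF; have [c [_ _ _ fr]] := face_cycle hF.
have -> : F = F°; last exact: open_interior.
apply/seteqP; split=> [x Fx|]; last exact: interior_subset.
apply: contrapT => nFx; apply: (face_sub hF Fx).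
have : frontier F x by split=> //; exact: subset_closure.
by rewrite fr => -[y _ <-]; exists y.
Qed.

(** The frontier is a union of closed cycle edges. A point of the open edge has support all of [e],
    so the cycle edge containing it must be [e]. *)
Lemma frontier_edge (F : set S) e y : faces i F -> is_edge e -> open_edge e y ->
  frontier F (i y) -> forall c, face_boundary_cycle F c ->
  exists2 v, v \in c & e = [set v; next c v].
Proof.
move=> hF he ey Fy c [_ _ cc fr]; move: Fy; rewrite fr => -[z [v vc vz] /i_inj zy].
subst z; exists v => //; apply: edge_sub_eq => //.
  by exists v, (next c v); split=> //; exact: next_cycle cc vc.
by move=> w /ey /vz.
Qed.

Lemma frontier_edge_sub (F : set S) e y : faces i F -> is_edge e -> open_edge e y ->
  frontier F (i y) -> i @` edge_points R e `<=` frontier F.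
Proof.
move=> hF he ey Fy; have [c cF] := face_cycle hF.
have [v vc ->] := frontier_edge hF he ey Fy cF.
have [_ _ _ ->] := cF.
by move=> _ [x xe <-]; exists x => //; exists v.
Qed.

Lemma flag_edge (F : set S) c v e : is_flag (v, e, F) -> face_boundary_cycle F c ->
  exists2 u, u \in c & e = [set u; next c u].
Proof.
move=> [he ev hF sub] cF; have [y ye] := open_edge_nonempty R he.
by apply: (frontier_edge hF he ye) cF; apply: sub; exists y => // w /ye.
Qed.

Lemma cycle_flag (F : set S) c u w : faces i F -> face_boundary_cycle F c -> u \in c ->
  [set u; next c u] w -> is_flag (w, [set u; next c u], F).
Proof.
move=> hF [_ _ cc fr] uc uw; split=> //.
  by exists u, (next c u); split=> //; exact: next_cycle cc uc.
by rewrite fr => _ [x xe <-]; exists x => //; exists u.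
Qed.

Definition adjacency_closed (Z : set (flag M)) := forall (j : 'I_3) Phi Psi,
  Z Phi -> is_flag Psi -> flag_adjacent j Phi Psi -> Z Psi.

(** The flags of a face are visited by going around its boundary cycle, alternating 0-adjacency and
    1-adjacency. *)
Lemma adjacency_closed_face (Z : set (flag M)) v e v' e' F : adjacency_closed Z ->
  is_flag (v', e', F) -> Z (v', e', F) -> is_flag (v, e, F) -> Z (v, e, F).
Proof.
move=> cZ fl' Z' fl; have hF : faces i F by case: fl.
have [c cF] := face_cycle hF; have [c2 uc cc _] := cF.
have [a' a'c e'E] := flag_edge fl' cF; have [a ac eE] := flag_edge fl cF.
subst e e'.
have next_neq u : u \in c -> u <> next c u.
  by move=> uc'; apply: adj_neq; exact: next_cycle cc uc'.
have all_of_edge u w w' : u \in c -> [set u; next c u] w -> [set u; next c u] w' ->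
    Z (w, [set u; next c u], F) -> Z (w', [set u; next c u], F).
  move=> uc' uw uw' Zw; have [<-//|/eqP ww'] := eqVneq w w'.
  apply: (cZ (@Ordinal 3 0 isT) _ _ Zw); first exact: cycle_flag.
  by split.
pose P u := Z (u, [set u; next c u], F).
have Pa' : P a'.
  by apply: (@all_of_edge _ v') => //; [case: fl'|left].
have step u : u \in c -> P u -> P (next c u).
  move=> uc' Pu; have uc'' : next c u \in c by rewrite mem_next.
  have Zn : Z (next c u, [set u; next c u], F).
    by apply: (@all_of_edge _ u) => //; [left|right].
  apply: (cZ (@Ordinal 3 1 isT) _ _ Zn); first by apply: cycle_flag => //; left.
  (* Consecutive edges differ because the cycle has length at least three. *)
  split=> // E.
  have : [set next c u; next c (next c u)] u by rewrite -E; left.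
  case=> [|uE]; first exact: next_neq.
  by have := next_next_neq uc c2 uc'; rewrite -uE eqxx.
apply: (@all_of_edge a a) => //; [by left|by case: fl|].
exact: (next_ind uc a'c Pa' step).
Qed.

Lemma adjacency_closed_edge (Z : set (flag M)) v e F v' F' : adjacency_closed Z ->
  is_flag (v', e, F') -> Z (v', e, F') -> is_flag (v, e, F) -> Z (v, e, F).
Proof.
move=> cZ fl' Z' fl; have [_ ev hF subF] := fl; have [he ev' hF' subF'] := fl'.
have fl0 : is_flag (v, e, F') by split.
have Z0 : Z (v, e, F').
  have [<-//|/eqP vv'] := eqVneq v' v.
  by apply: (cZ (@Ordinal 3 0 isT) _ _ Z') => //; split.
have [<-//|FF'] := pselect (F' = F).
by apply: (cZ (@Ordinal 3 2 isT) _ _ Z0) => //; split.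
Qed.

(** Choose [N] connected and meeting the graph only in this open edge. A face meeting [N] cannot
    contain it, so its frontier meets [N], necessarily on the edge, and then contains the whole
    edge. *)
Lemma edge_neighborhood e y : is_edge e -> open_edge e y ->
  exists N : set S, [/\ open N, N (i y) &
    forall z, N z -> (i @` open_edge e) z \/
      exists F, [/\ faces i F, i @` edge_points R e `<=` frontier F & F z]].
Proof.
move=> he ey; have [_ /(_ (open_edge e)) [/(_ (open_edge_open R he)) [W oW WE] _]] := embP M.
have Wy : W (i y) by rewrite WE in ey.
have [_ _ _ lE] := surfP M.
have [N [oN Ny NW cN _]] := punctured_neighborhood lE oW Wy.
exists N; split=> // z Nz; have [[x _ xz]|nz] := pselect (range i z).
  by left; exists x => //; have := NW _ Nz; rewrite -xz WE.
right; have [F hF Fz] := face_exists nz; exists F; split=> //.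
have [H|/eqP/set0P[s [Ns Fs]]] := pselect (N `&` frontier F = set0).
  have [NF|H'] := connected_frontier_disjoint (face_open hF) cN H.
    by case: (face_sub hF (NF _ Ny)); exists y.
  by have : set0 z by rewrite -H'.
have [c [_ _ _ fr]] := face_cycle hF.
have [x xs] : exists x, i x = s by move: Fs; rewrite fr => -[x _ xs]; exists x.
apply: (frontier_edge_sub hF he (y := x)); last by rewrite xs.
by rewrite WE /= xs; exact: NW.
Qed.

Lemma vertex_neighborhood (v : V) : exists N : set S,
  [/\ open N, N (i (vertex_point R v)), connected (N `\ i (vertex_point R v)) &
   forall w, N (i (vertex_point R w)) -> w = v].
Proof.
have [_ /(_ [set x : realization R V | (val x v != 0)%R])] := embP M.
move=> [/(_ (open_support R v)) [W oW WE] _].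
have Wv : W (i (vertex_point R v)).
  have : [set x : realization R V | (val x v != 0)%R] (vertex_point R v).
    by rewrite /= eqxx oner_eq0.
  by rewrite WE.
have [_ _ _ lE] := surfP M.
have [N [oN Ny NW _ cN]] := punctured_neighborhood lE oW Wv.
exists N; split=> // w /NW Ww.
have : [set x : realization R V | (val x v != 0)%R] (vertex_point R w) by rewrite WE.
by rewrite /=; case: (eqVneq v w) => // _; rewrite eqxx.
Qed.

Let vertices : set S := range (fun v => i (vertex_point R v)).

(* Excludes pinched points, around which the flags would not be connected. *)
Lemma connected_minus_vertices (P Q : set S) : open P -> open Q -> P `&` Q = set0 ->
  P `<=` ~` vertices -> Q `<=` ~` vertices -> ~` vertices `<=` P `|` Q ->
  P !=set0 -> Q = set0.
Proof.
move=> oP oQ PQ PnV QnV cover [x0 Px0].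
have nPQ u : P u -> Q u -> False by move=> Pu Qu; have : set0 u by rewrite -PQ.
(* Add to [P] the vertices with a punctured neighborhood inside [P]. Since small punctured
   neighborhoods are connected, [P'] and its complement are both open. *)
pose P' := [set x | P x \/ vertices x /\ exists N : set S, [/\ open N, N x & N `\ x `<=` P]].
have oP' : open P'.
  rewrite openE => x [Px|[Vx [N [oN Nx NP]]]].
    by apply: (interior_witness oP) => // u Pu; left.
  apply: (interior_witness oN) => // u Nu.
  have [->|ux] := pselect (u = x); last by left; apply: NP.
  by right; split=> //; exists N.
have oP'C : open (~` P').
  rewrite openE => x nP'x; have [[v _ vx]|nVx] := pselect (vertices x); last first.
    have [Px|Qx] := cover x nVx; first by case: nP'x; left.
    by apply: (interior_witness oQ) => // u Qu [Pu|[Vu _]]; [exact: (nPQ u)|exact: QnV Vu].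
  have [N [oN Nx cN NV]] := vertex_neighborhood v; rewrite vx in Nx cN.
  have sN : N `\ x `<=` P `|` Q.
    move=> u [Nu ux]; apply: cover => -[w _ wu]; apply: ux => /=.
    by rewrite -wu -vx (NV w) // wu.
  have [NP|NQ] := connected_open_pair cN oP oQ PQ sN.
    by case: nP'x; right; split; [exists v|exists N].
  apply: (interior_witness oN) => // u Nu P'u; have [ux|ux] := pselect (u = x).
    by apply: nP'x; rewrite -ux.
  have Qu : Q u by apply: NQ.
  by case: P'u => [Pu|[Vu _]]; [exact: (nPQ u)|exact: QnV Vu].
have [_ _ cS _] := surfP M.
have P'T : P' = setT.
  apply: cS; first by exists x0; left.
    by exists P' => //; rewrite setTI.
  by exists P'; [rewrite -[P']setCK; exact: open_closedC|rewrite setTI].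
apply/seteqP; split=> // z Qz; have : P' z by rewrite P'T.
by case=> [Pz|[Vz _]]; [exact: (nPQ z)|exact: QnV Vz].
Qed.

(** The faces and open edges reached by [Z] form an open set, and so do the unreached ones.
    Connectedness of the surface minus the vertices leaves nothing unreached. *)
Lemma all_flags (Z : set (flag M)) Phi0 : adjacency_closed Z -> is_flag Phi0 -> Z Phi0 ->
  (forall Psi, is_flag Psi -> Z Psi) /\ (forall v : V, exists e F, is_flag (v, e, F)).
Proof.
move=> cZ fl0 Z0.
pose ZF F := exists v e, is_flag (v, e, F) /\ Z (v, e, F).
pose ZE e := exists v F, is_flag (v, e, F) /\ Z (v, e, F).
pose P := [set x | (exists2 F, ZF F & F x) \/ exists2 e, ZE e & (i @` open_edge e) x].
pose Q := ~` (P `|` vertices).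
have flag_of e F y : is_edge e -> faces i F -> open_edge e y ->
    i @` edge_points R e `<=` frontier F ->
    exists v, is_flag (v, e, F).
  by move=> he hF ye sub; have [a [b [_ eE]]] := he; exists a; split=> //; rewrite eE; left.
have PnV : P `<=` ~` vertices.
  move=> x [[F [v [e [[_ _ hF _] _]]] Fx] [w _ wx]|[e [v [F [[he _ _ _] _]]] [y ye yx]] [w _ wx]].
    by apply: (face_sub hF Fx); exists (vertex_point R w).
  by move: wx; rewrite -yx => /i_inj wy; move: ye; rewrite -wy; exact: vertex_not_open_edge.
(* Near an open edge, reachability is uniform: all incident faces share its status. *)
have nbhd e y : is_edge e -> open_edge e y -> exists N : set S, [/\ open N, N (i y) &
    (ZE e -> N `<=` P) /\ (~ ZE e -> N `<=` Q)].
  move=> he ye; have [N [oN Ny HN]] := edge_neighborhood he ye; exists N; split=> //.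
  split=> [Ze z /HN[ze|[F [hF sub Fz]]]|nZe z /HN[[x xe <-]|[F [hF sub Fz]]]].
  - by right; exists e.
  - left; exists F => //; have [v fl] := flag_of _ _ _ he hF ye sub.
    have [v' [F' [fl' Z']]] := Ze; exists v, e; split=> //.
    exact: adjacency_closed_edge fl' Z' fl.
  - case=> [[[F [v' [e' [[_ _ hF _] _]]] Fx]|[e' Ze' [x' xe' /i_inj xx']]]|[w _ /i_inj wx]].
    + by apply: (face_sub hF Fx); exists x.
    + by apply: nZe; subst x'; rewrite (open_edge_eq xe xe').
    + by move: xe; rewrite -wx; exact: vertex_not_open_edge.
  - case=> [[[F' [v' [e' [fl' Z']]] Fx]|[e' Ze' [x' xe' xx']]]|[w _ wx]].
    + have hF' : faces i F' by case: fl'.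
      have FF' := face_meet_eq hF hF' Fz Fx; subst F'.
      have [v fl] := flag_of _ _ _ he hF ye sub.
      by apply: nZe; exists v, F; split=> //; exact: adjacency_closed_face fl' Z' fl.
    + by apply: (face_sub hF Fz); exists x'.
    + by apply: (face_sub hF Fz); exists (vertex_point R w).
have open_in (A : set S) x : (exists N : set S, [/\ open N, N x & N `<=` A]) -> A° x.
  by move=> [N [oN Nx NA]]; exact: interior_witness NA.
have oP : open P.
  rewrite openE => x [[F ZFF Fx]|[e Ze [y ye yx]]]; apply: open_in.
    exists F; split=> //; last by move=> u Fu; left; exists F.
    by apply: face_open; have [v [e [[]]]] := ZFF.
  have he : is_edge e by have [v [F [[]]]] := Ze.
  by have [N [oN Ny [NP _]]] := nbhd _ _ he ye; exists N; rewrite -yx; split=> //; exact: NP.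
have oQ : open Q.
  rewrite openE => x nPV; apply: open_in.
  have [[r _ rx]|nr] := pselect (range i x).
    have [[v vE]|[e he re]] := realization_cases r.
      by case: nPV; right; exists v => //; rewrite -rx vE.
    have [N [oN Nx [NP NQ]]] := nbhd _ _ he re; exists N; rewrite -rx; split=> //.
    have [Ze|] := pselect (ZE e); last exact: NQ.
    by case: nPV; left; rewrite -rx; exact: NP.
  have [F hF Fx] := face_exists nr; exists F; split=> //; first exact: face_open.
  move=> u Fu [[[F' ZF' F'u]|[e _ [y _ yu]]]|[v _ vu]].
  - have hF' : faces i F' by have [v [e [[]]]] := ZF'.
    by apply: nPV; left; left; exists F => //; rewrite (face_meet_eq hF hF' Fu F'u).
  - by apply: (face_sub hF Fu); exists y.
  - by apply: (face_sub hF Fu); exists (vertex_point R v).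
have Q0 : Q = set0.
  apply: (connected_minus_vertices oP oQ) => //.
  - by apply/seteqP; split=> // x [Px]; apply; left.
  - by move=> x nPV Vx; apply: nPV; right.
  - move=> x nVx; have [Px|nPx] := pselect (P x); first by left.
    by right => -[].
  - move: Phi0 fl0 Z0 => [[v e] F] fl Zf; have [_ _ [x nx FE] _] := fl.
    by exists x; left; exists F; [exists v, e|rewrite FE; exact: connected_component_refl].
have edgeZ e : is_edge e -> ZE e.
  move=> he; have [y ye] := open_edge_nonempty R he.
  have [N [_ Ny [_ NQ]]] := nbhd _ _ he ye.
  by apply: contrapT => /NQ/(_ _ Ny); rewrite Q0.
split=> [[[v e] F] fl|v].
  have [he _ _ _] := fl; have [v' [F' [fl' Z']]] := edgeZ e he.
  exact: adjacency_closed_edge fl' Z' fl.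
(* All degrees equal [q], and [q] is nonzero because [Phi0] contains an edge. *)
have [w vw] : exists w, adj v w.
  apply: contrapT => nw; have q0 : q = 0%N.
    have := proj1 hpq v; have -> : [set w | adj v w] = set0.
      by apply/seteqP; split=> // w vw; apply: nw; exists w.
    by rewrite card_eq_sym card_eq0 => /eqP H; case: q H => // n /seteqP[/(_ 0%N)]; case.
  move: Phi0 fl0 Z0 => [[v0 e0] F0] [[a [b [ab _]]] _ _ _] _.
  have := proj1 hpq a; rewrite q0 II0 card_eq0 => /eqP /seteqP[/(_ b ab)].
  by [].
have [v' [F' [[he _ hF sub] _]]] := edgeZ [set v; w] (ex_intro _ v (ex_intro _ w (conj vw erefl))).
by exists [set v; w], F'; split=> //; left.
Qed.

End FlagConnectivity.

(** * Automorphisms acting on flags *)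

Lemma uniq_card_le (T : choiceType) (A : set T) n (s : seq T) : A #= `I_n ->
  uniq s -> (forall x, x \in s -> A x) -> (size s <= n)%N.
Proof.
move=> An us sA; have fA : finite_set A by exists n.
rewrite -(card_fset_set An); apply: uniq_leq_size => // x xs.
by rewrite in_fset_set //; exact/mem_set/sA.
Qed.

Lemma torsion_mulC (G : groupType) (x y : G) : torsion (x * y)%g -> torsion (y * x)%g.
Proof.
move=> [n xyn]; exists n; have E m : ((y * x) ^+ m * y = y * (x * y) ^+ m)%g.
  elim: m => [|m IHm]; first by rewrite !expg0 mul1g mulg1.
  by rewrite expgS -mulgA IHm expgS !mulgA.
by have := E n.+1; rewrite xyn mulg1 -[RHS]mul1g => /mulIg.
Qed.

Section FlagAction.
Context (R : realType) (M : surface_map R).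
Local Notation S := (surf M).
Local Notation V := (graph M).
Local Notation i := (@emb R M).
Local Open Scope group_scope.

Lemma homeo_connected_component (f : homeo S S) (A : set S) x :
  A x -> (forall y, A (f y) <-> A y) ->
  f @` connected_component A x = connected_component A (f x).
Proof.
move=> Ax fA.
have sub (g : homeo S S) z : A z -> (forall y, A (g y) <-> A y) ->
    g @` connected_component A z `<=` connected_component A (g z).
  move=> Az gA; apply: connected_component_max.
  - by exists z => //; exact: connected_component_refl.
  - by move=> _ [y /connected_component_sub Ay <-]; exact/gA.
  - apply: connected_continuous_connected; first exact: component_connected.
    exact/continuous_subspaceT/homeo_fun_cont.
apply/seteqP; split; first exact: sub.
move=> y fy; exists (homeo_inv f y); last by rewrite homeo_invK.
have invA z : A (homeo_opp f z) <-> A z by rewrite -fA /= homeo_invK.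
have := @sub (homeo_opp f) (f x) ((fA x).2 Ax) invA (homeo_inv f y).
by rewrite /= homeo_funK; apply; exists y.
Qed.

Lemma homeo_frontier (f : homeo S S) (F : set S) : f @` frontier F `<=` frontier (f @` F).
Proof.
move=> _ [x [cF nF] <-]; split.
  move=> B /(@homeo_fun_cont _ _ f _) /cF [y [Fy By]]; by exists (f y); split=> //; exists y.
move=> H; apply: nF; have : nbhs x (f @^-1` (f @` F)) := homeo_fun_cont H.
by apply: filterS => y [z Fz] /(can_inj (@homeo_funK _ _ f)) <-.
Qed.

Lemma preauto_emb (f : preauto M) x : (val f : homeo S S) (i x) = i (realize R (preauto_phi f) x).
Proof. by have /(congr1 (@^~ x)) := preauto_phiP f. Qed.

Lemma is_flag_act (f : preauto M) (Phi : flag M) : is_flag Phi -> is_flag (flag_act f Phi).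
Proof.
case: Phi => -[v e] F /= [he ev [x nx FE] sub]; set g := preauto_phi f.
have realizeK y : realize R g (realize R g^-1 y) = y.
  by apply: val_inj; apply/funext => w /=; rewrite gauto_invK.
have rangeE y : (~` range i) ((val f : homeo S S) y) <-> (~` range i) y.
  split=> n [z _ zE]; apply: n.
    by exists (realize R g z) => //; rewrite -zE preauto_emb.
  exists (realize R g^-1 z) => //; apply: (can_inj (@homeo_funK _ _ (val f))).
  by rewrite preauto_emb realizeK.
split.
- move: he => [a [b [ab ->]]]; exists (g a), (g b); rewrite gauto_adj; split=> //.
  by rewrite image_setU !image_set1.
- by exists v.
- exists ((val f : homeo S S) x); first exact/rangeE.
  by rewrite FE; exact: homeo_connected_component.
- move=> _ [y ye <-]; rewrite -(realizeK y) -preauto_emb.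
  apply: homeo_frontier; exists (i (realize R g^-1 y)) => //; apply: sub.
  exists (realize R g^-1 y) => // w /= /ye [u eu /(congr1 (gauto_inv g))].
  by rewrite !gauto_funK => <-.
Qed.

Lemma flag_adjacent_act (f : preauto M) j Phi Psi :
  flag_adjacent j Phi Psi -> flag_adjacent j (flag_act f Phi) (flag_act f Psi).
Proof.
have injV (T U : Type) (h : T -> U) (A B : set T) : injective h -> h @` A = h @` B -> A = B.
  move=> hI AB; apply/seteqP; split=> x xA.
    by have : (h @` A) (h x) by [exists x]; rewrite AB => -[y By /hI <-].
  by have : (h @` B) (h x) by [exists x]; rewrite -AB => -[y By /hI <-].
have gI := can_inj (@gauto_funK _ (preauto_phi f)).
have fI := can_inj (@homeo_funK _ _ (val f)).
case: Phi Psi => -[v e] F [[v' e'] F']; rewrite /flag_adjacent /flag_act.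
by case: (val j) => [|[|?]] [a b c]; split=> //;
  try (by move/gI); try (by move/injV => /(_ gI)); try (by move/injV => /(_ fI)); congruence.
Qed.

Lemma flag_adjacent_sym j (Phi Psi : flag M) : flag_adjacent j Phi Psi -> flag_adjacent j Psi Phi.
Proof.
case: Phi Psi => -[v e] F [[v' e'] F']; rewrite /flag_adjacent.
by case: (val j) => [|[|?]] [a b c]; split=> //; exact: nesym.
Qed.

Lemma preauto_mulE (f g : preauto M) :
  preauto_phi (f * g) = preauto_phi f * preauto_phi g.
Proof. exact: preauto_phiM. Qed.

Lemma flag_actM (f g : preauto M) Phi : flag_act (f * g) Phi = flag_act f (flag_act g Phi).
Proof.
case: Phi => -[v e] F; have E := preauto_mulE f g; congr (_, _, _).
- exact: (congr1 (fun h : gauto V => h v) E).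
- rewrite image_comp; exact: (congr1 (fun h : gauto V => h @` e) E).
- by rewrite image_comp.
Qed.

Lemma flag_act1 (Phi : flag M) : flag_act 1 Phi = Phi.
Proof.
case: Phi => -[v e] F; rewrite /flag_act.
have -> : preauto_phi (1 : preauto M) = 1 by exact: kq_gmulf1.
by congr (_, _, _); rewrite -[RHS]image_id.
Qed.

Lemma flag_actK (f : preauto M) : cancel (flag_act f) (flag_act f^-1).
Proof. by move=> Phi; rewrite -flag_actM mulVg flag_act1. Qed.

Lemma Aut_class_eq (f g : preauto M) :
  Aut_class f = Aut_class g <-> preauto_phi f = preauto_phi g.
Proof.
by split=> [/(kq_eqP (preauto_phi (M := M)))/eqP|/eqP/(kq_eqP (preauto_phi (M := M)))].
Qed.

Lemma Aut_classM (f g : preauto M) : Aut_class (f * g) = Aut_class f * Aut_class g.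
Proof.
apply/(kq_eqP (preauto_phi (M := M))); have E := preauto_mulE f g.
have E' := preauto_mulE (repr (Aut_class f)) (repr (Aut_class g)).
apply/eqP; apply: (etrans E); apply/esym/(etrans E').
by congr (_ * _); exact: (kq_repr (preauto_phi (M := M))).
Qed.

Lemma Aut_classX (f : preauto M) n : Aut_class (f ^+ n) = Aut_class f ^+ n.
Proof. by elim: n => [//|n IHn]; rewrite !expgS Aut_classM IHn. Qed.

Lemma Aut_classV (f : preauto M) : Aut_class f^-1 = (Aut_class f)^-1.
Proof. by apply: (mulIg (Aut_class f)); rewrite -Aut_classM !mulVg. Qed.

Lemma Aut_class_surj (a : Aut M) : exists f, Aut_class f = a.
Proof. by exists (repr a); exact: reprK. Qed.

End FlagAction.

(** * Free action on flags, stabilizers and generators *)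

Section FlagTransport.
Context (R : realType) (M : surface_map R).
Local Notation S := (surf M).
Local Notation V := (graph M).
Local Notation i := (@emb R M).
Local Open Scope group_scope.

Context (p q : nat).
Context (hpq : schlafli_type M p q).
Context (uniq_adj : unique_adjacent_flags M).

Lemma adjacent_uniq j (Phi Psi Psi' : flag M) : is_flag Phi -> is_flag Psi -> is_flag Psi' ->
  flag_adjacent j Phi Psi -> flag_adjacent j Phi Psi' -> Psi = Psi'.
Proof.
move=> fl fP fP' a a'; have [X [_ uX]] := uniq_adj fl j.
by rewrite -(uX Psi) // -(uX Psi').
Qed.

Lemma adjacent_exists j (Phi : flag M) : is_flag Phi ->
  exists2 Psi, is_flag Psi & flag_adjacent j Phi Psi.
Proof. by move=> fl; have [X [[fX aX] _]] := uniq_adj fl j; exists X. Qed.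

(** Uniqueness of adjacent flags makes the set of fixed flags closed under adjacency. Hence every
    flag, and with it every vertex, is fixed. *)
Lemma fixed_flag_trivial (f : preauto M) Phi : is_flag Phi -> flag_act f Phi = Phi ->
  preauto_phi f = 1.
Proof.
move=> fl fPhi.
have cZ : adjacency_closed [set Psi : flag M | is_flag Psi /\ flag_act f Psi = Psi].
  move=> j Psi Psi' [fP fPsi] fP' a; split=> //.
  apply: (adjacent_uniq (j := j) fP) => //; first exact: is_flag_act.
  by rewrite -[X in flag_adjacent j X]fPsi; exact: flag_adjacent_act.
have [all_fixed vertex_flag] := all_flags hpq cZ fl (conj fl fPhi).
apply: gauto_ext => v; have [e [F fv]] := vertex_flag v.
by have [_ []] := all_fixed _ fv.
Qed.

Lemma Aut_class_eq_flag (f g : preauto M) Phi : is_flag Phi ->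
  flag_act f Phi = flag_act g Phi -> Aut_class f = Aut_class g.
Proof.
move=> fl fg; suff : Aut_class (f^-1 * g) = 1.
  by rewrite Aut_classM Aut_classV => /(congr1 (fun x => Aut_class f * x)); rewrite mulVKg mulg1.
apply/Aut_class_eq; rewrite (kq_gmulf1 (preauto_phi (M := M))).
by apply: (fixed_flag_trivial fl); rewrite flag_actM -fg flag_actK.
Qed.

(** Two powers of [f] agree on [Phi] by the pigeonhole principle, and freeness of the action makes
    their quotient trivial. *)
Lemma torsion_invariant_flags (f : preauto M) Phi (D : set (flag M)) :
  is_flag Phi -> finite_set D -> D Phi -> (forall Psi, D Psi -> D (flag_act f Psi)) ->
  torsion (Aut_class f).
Proof.
move=> fl fD DPhi fDD; have Dn n : D (flag_act (f ^+ n) Phi).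
  elim: n => [|n IHn]; first by rewrite expg0 flag_act1.
  by rewrite expgS flag_actM; exact: fDD.
have [m [n mn E]] : exists m, exists2 n, (m < n)%N &
    flag_act (f ^+ m) Phi = flag_act (f ^+ n) Phi.
  apply: contrapT => H; have := infinite_nat; apply.
  have inj : injective (fun n => flag_act (f ^+ n) Phi).
    move=> m n E; apply/eqP; apply: contrapT => /negP; rewrite neq_ltn => /orP[mn|nm].
      by apply: H; exists m, n.
    by apply: H; exists n, m.
  apply: sub_finite_set (finite_preimage (B := D) (f := fun n => flag_act (f ^+ n) Phi) _ fD).
    by move=> k _; exact: Dn.
  by move=> m n _ _; exact: inj.
have := Aut_class_eq_flag fl E; rewrite !Aut_classX -(subnK (ltnW mn)) expgnDr => fmn.
(* The predecessor matches the exponent [n.+1] in [torsion]. *)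
exists (n - m).-1; rewrite prednK ?subn_gt0 //.
by apply: (mulIg (Aut_class f ^+ m)); rewrite mul1g -fmn.
Qed.

(** An edge has two endpoints and, by uniqueness of 2-adjacent flags, at most two incident faces. *)
Lemma finite_edge_flags (e : set V) : finite_set [set Psi : flag M | is_flag Psi /\ Psi.1.2 = e].
Proof.
have [[[[v e'] F] [fl /= eE]]|no] :=
    pselect (exists Psi : flag M, is_flag Psi /\ Psi.1.2 = e); last first.
  by apply: (@sub_finite_set _ _ set0) => // Psi H; apply: no; exists Psi.
subst e'; have [he ev hF sub] := fl; have [a [b [ab eE]]] := he.
have [[[v' e'] F'] fl' [vv' ee' FF']] := adjacent_exists (@Ordinal 3 2 isT) fl.
have fT : finite_set ([set a; b] `*` [set F; F']) by apply: finite_setX; rewrite finite_setU.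
apply: sub_finite_set (finite_image (fun x => (x.1, e, x.2)) fT) => -[[w e''] G] [flG /= E].
subst e''; exists (w, G) => //; have [_ ew hG subG] := flG; have wab : [set a; b] w by rewrite -eE.
split=> //=.
have flvG : is_flag (v, e, G) by split.
have [->|GF] := pselect (G = F); first by left.
right; have := @adjacent_uniq (@Ordinal 3 2 isT) _ _ _ fl fl' flvG.
by move=> /(_ (And3 vv' ee' FF') (And3 erefl erefl (nesym GF))) [].
Qed.

Lemma finite_vertex_flags (v : V) : finite_set [set Psi : flag M | is_flag Psi /\ Psi.1.1 = v].
Proof.
apply: (@sub_finite_set _ _ (\bigcup_(w in [set w | adj v w])
    [set Psi : flag M | is_flag Psi /\ Psi.1.2 = [set v; w]])).
  move=> [[v' e] F] [fl /= vE]; subst v'; have [[a [b [ab eE]]] ev _ _] := fl.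
  have [/= vE|/= vE] : [set a; b] v by rewrite -eE.
    by subst v; exists b.
  by subst v; exists a; [rewrite /= adj_sym|split=> //=; rewrite eE setUC].
by apply: bigcup_finite => [|w _]; [exact: graphP|exact: finite_edge_flags].
Qed.

Lemma finite_face_flags (F : set S) : finite_set [set Psi : flag M | is_flag Psi /\ Psi.2 = F].
Proof.
have [hF|nF] := pselect (faces i F); last first.
  by apply: (@sub_finite_set _ _ set0) => // -[[v e] G] [[_ _ hG _] /= GF]; apply: nF; rewrite -GF.
have [c _ cF] := proj2 hpq F hF.
have fT : finite_set ([set` c] `*` [set` c]) by apply: finite_setX; exact: finite_seq.
apply: sub_finite_set (finite_image (fun x => (x.1, [set x.2; next c x.2], F)) fT).
move=> [[v e] G] [fl /= GF]; subst G; have [u uc eE] := flag_edge fl cF.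
exists (v, u); last by rewrite /= eE.
have [_ + _ _] := fl; rewrite eE => -[] /= ->; split=> //=.
by rewrite mem_next.
Qed.

(* The component of a flag that [k]-adjacency changes. *)
Definition fixes_component (k : nat) (f : preauto M) (Phi : flag M) : Prop :=
  match k with
  | 0 => (flag_act f Phi).1.1 = Phi.1.1
  | 1 => (flag_act f Phi).1.2 = Phi.1.2
  | _ => (flag_act f Phi).2 = Phi.2
  end.

Lemma fixes_componentM k f g Phi : fixes_component k f Phi -> fixes_component k g Phi ->
  fixes_component k (f * g) Phi.
Proof.
rewrite /fixes_component flag_actM; case: Phi => -[v e] F.
by case: k => [|[|k]] /= Hf Hg; rewrite Hg.
Qed.

Lemma fixes_component_torsion k f Phi : is_flag Phi -> fixes_component k f Phi ->
  torsion (Aut_class f).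
Proof.
case: Phi => -[v e] F fl.
case: k => [|[|k]] /= Hf.
- apply: (torsion_invariant_flags fl (finite_vertex_flags v)) => // -[[v' e'] F'] [fl' E].
  by split; [exact: is_flag_act|rewrite /= in E *; rewrite E].
- apply: (torsion_invariant_flags fl (finite_edge_flags e)) => // -[[v' e'] F'] [fl' E].
  by split; [exact: is_flag_act|rewrite /= in E *; rewrite E].
- apply: (torsion_invariant_flags fl (finite_face_flags F)) => // -[[v' e'] F'] [fl' E].
  by split; [exact: is_flag_act|rewrite /= in E *; rewrite E].
Qed.

Lemma adjacent_fixes (j : 'I_3) k f Phi : val j <> k -> (k < 3)%N ->
  flag_adjacent j Phi (flag_act f Phi) -> fixes_component k f Phi.
Proof.
rewrite /fixes_component; case: Phi => -[v e] F; rewrite /flag_adjacent.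
by case: j => [[|[|[|j]]] jlt] //=; case: k => [|[|[|k]]] //= _ _ [].
Qed.

Lemma mem_flag_orbit (f : preauto M) Phi : flag_orbit Phi (flag_act f Phi).
Proof. by exists (Aut_class f), f. Qed.

Lemma flag_orbit_sub (f : preauto M) Phi : flag_orbit (flag_act f Phi) `<=` flag_orbit Phi.
Proof. by move=> _ [_ [g _ ->]]; rewrite -flag_actM; exact: mem_flag_orbit. Qed.

Lemma flag_orbit_act (f : preauto M) Phi : flag_orbit (flag_act f Phi) = flag_orbit Phi.
Proof.
apply/seteqP; split; first exact: flag_orbit_sub.
by rewrite -{1}(flag_actK f Phi); exact: flag_orbit_sub.
Qed.

Lemma flag_orbit_eqP (Phi Psi : flag M) : flag_orbit Phi = flag_orbit Psi ->
  exists f, Psi = flag_act f Phi.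
Proof.
move=> E; have : flag_orbit Phi Psi.
  by rewrite E -{2}(flag_act1 Psi); exact: mem_flag_orbit.
by move=> [_ [f _ ->]]; exists f.
Qed.

Lemma exists_flag_orbit n : (0 < n)%N -> @flag_orbits R M #= `I_n ->
  exists Phi : flag M, is_flag Phi.
Proof.
move=> n0 orb; apply: contrapT => H; have H0 : @flag_orbits R M = set0.
  by apply/seteqP; split=> // O [Phi fl _]; apply: H; exists Phi.
move: orb; rewrite H0 card_eq_sym card_eq0 => /eqP/seteqP[/(_ 0%N n0)].
by [].
Qed.

(** Take [f j] carrying [Phi] to its [j]-adjacent flag. The [j]-neighbor of [flag_act h Phi] is
    [flag_act (h * f j) Phi], so walking along flags multiplies by generators. A product of two of
    them fixes a component of [Phi] whose index differs from both. *)
Lemma regular_generators : @flag_orbits R M #= `I_1 ->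
  exists2 t : 'I_3 -> Aut M, generates (range t) &
    (forall j, torsion (t j)) /\ forall j k, torsion (t j * t k).
Proof.
move=> orb; have [Phi fl] := @exists_flag_orbit 1 isT orb.
have same Psi : is_flag Psi -> exists f, Psi = flag_act f Phi.
  move=> fP; apply: flag_orbit_eqP; apply: contrapT => /eqP ne.
  have us : uniq [:: flag_orbit Phi; flag_orbit Psi] by rewrite /= inE ne.
  have := uniq_card_le orb us; apply/not_implyP; split=> // x.
  by rewrite !inE => /orP[]/eqP ->; [exists Phi|exists Psi].
have /choice[f fP] j : exists f, flag_adjacent j Phi (flag_act f Phi).
  by have [Psi /same[f ->] a] := adjacent_exists j fl; exists f.
exists (fun j => Aut_class (f j)).
  move=> H H1 HM HV sub; apply/seteqP; split=> // a _.
  have [g <-] := Aut_class_surj a.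
  pose Z := [set Psi | exists2 h, H (Aut_class h) & Psi = flag_act h Phi].
  have cZ : adjacency_closed Z.
    move=> j _ Psi [h Hh ->] fP' adjP; exists (h * f j).
      by rewrite Aut_classM; apply: HM => //; apply: sub; exists j.
    apply: (adjacent_uniq (j := j) (is_flag_act h fl)) => //; first exact: is_flag_act.
    by rewrite flag_actM; exact: flag_adjacent_act.
  have ZPhi : Z Phi by exists 1; rewrite ?flag_act1.
  have [h Hh gh] := (all_flags hpq cZ fl ZPhi).1 _ (is_flag_act g fl).
  by rewrite (Aut_class_eq_flag fl gh).
have fix_other (j k : 'I_3) : j != k -> fixes_component k (f j) Phi.
  by move=> /eqP jk; apply: adjacent_fixes (fP j) => // E; apply: jk; exact: val_inj.
have third (j k : 'I_3) : exists l : 'I_3, (j != l) && (k != l).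
  by case: j k => [[|[|[|//]]] ?] [[|[|[|//]]] ?];
    first [by exists (@Ordinal 3 0 isT)|by exists (@Ordinal 3 1 isT)|by exists (@Ordinal 3 2 isT)].
split=> [j|j k].
  have [l /andP[jl _]] := third j j; exact: fixes_component_torsion (fix_other _ _ jl).
have [l /andP[jl kl]] := third j k; rewrite -Aut_classM.
by apply: (fixes_component_torsion (k := l) fl); apply: fixes_componentM; exact: fix_other.
Qed.

(** With two alternating orbits, two adjacencies lead back to the orbit of [Phi]. This gives
    rotations [a] about the face and [b] about the vertex of [Phi], and [a * b] preserves its
    edge. *)
Lemma chiral_generators : @flag_orbits R M #= `I_2 ->
  (forall (j : 'I_3) (Phi Psi : flag M), is_flag Phi -> is_flag Psi ->
    flag_adjacent j Phi Psi -> flag_orbit Phi <> flag_orbit Psi) ->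
  exists2 t : bool -> Aut M, generates (range t) &
    (forall j, torsion (t j)) /\ forall j k, torsion (t j * t k).
Proof.
move=> orb alt; have [Phi fl] := @exists_flag_orbit 2 isT orb.
have two_step j k Psi Psi' : is_flag Psi -> is_flag Psi' -> flag_adjacent j Phi Psi ->
    flag_adjacent k Psi Psi' -> exists f, Psi' = flag_act f Phi.
  move=> fP fP' a a'; apply: flag_orbit_eqP; apply: contrapT => /eqP ne.
  have us : uniq [:: flag_orbit Phi; flag_orbit Psi; flag_orbit Psi'].
    rewrite /= !inE negb_or ne andbT andbT; apply/andP; split; apply/eqP.
      exact: alt a.
    exact: alt a'.
  have := uniq_card_le orb us; apply/not_implyP; split=> // x.
  by rewrite !inE => /or3P[]/eqP ->; [exists Phi|exists Psi|exists Psi'].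
pose j0 := @Ordinal 3 0 isT; pose j1 := @Ordinal 3 1 isT; pose j2 := @Ordinal 3 2 isT.
have [Phi0 fl0 a0] := adjacent_exists j0 fl.
have [Phi1 fl1 a1] := adjacent_exists j1 fl.
have [Phi2 fl2 a2] := adjacent_exists j2 fl.
have [Phi01 fl01 a01] := adjacent_exists j1 fl0.
have [Phi12 fl12 a12] := adjacent_exists j2 fl1.
have [a aE] := two_step _ _ _ _ fl0 fl01 a0 a01.
have [b bE] := two_step _ _ _ _ fl1 fl12 a1 a12.
(* Both flags are 1-adjacent to [Phi01], the image of [Phi] under [a]. *)
have aPhi1 : flag_act a Phi1 = Phi0.
  apply: (adjacent_uniq (j := j1) fl01) => //; first exact: is_flag_act.
    by rewrite aE; exact: flag_adjacent_act.
  exact: flag_adjacent_sym.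
have bPhi2 : flag_act b Phi2 = Phi1.
  apply: (adjacent_uniq (j := j2) fl12) => //; first exact: is_flag_act.
    by rewrite bE; exact: flag_adjacent_act.
  exact: flag_adjacent_sym.
have Phi1E : Phi1 = flag_act a^-1 Phi0 by rewrite -aPhi1 flag_actK.
have Phi2E : Phi2 = flag_act (b^-1 * a^-1) Phi0 by rewrite flag_actM -Phi1E -bPhi2 flag_actK.
have abE : flag_adjacent j2 Phi0 (flag_act (a * b) Phi).
  by rewrite flag_actM -bE -{1}aPhi1; exact: flag_adjacent_act.
exists (fun c => if c then Aut_class a else Aut_class b).
  move=> H H1 HM HV sub; apply/seteqP; split=> // x _.
  have [g <-] := Aut_class_surj x.
  have Ha : H (Aut_class a) by apply: sub; exists true.
  have Hb : H (Aut_class b) by apply: sub; exists false.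
  (* [Phi] and [Phi0] represent the two orbits, which every adjacency exchanges. *)
  pose Z := [set Psi | exists2 h, H (Aut_class h) & Psi = flag_act h Phi \/ Psi = flag_act h Phi0].
  have neighbor (h : preauto M) (j : 'I_3) (X Y Psi : flag M) :
      is_flag X -> is_flag Y -> flag_adjacent j X Y ->
      is_flag Psi -> flag_adjacent j (flag_act h X) Psi -> Psi = flag_act h Y.
    move=> fX fY XY fP hXP; apply: (adjacent_uniq (j := j) (is_flag_act h fX)) => //.
      exact: is_flag_act.
    exact: flag_adjacent_act.
  have case3 (P : 'I_3 -> Prop) : P j0 -> P j1 -> P j2 -> forall j, P j.
    move=> P0 P1 P2 [[|[|[|//]]] lt];
      [move: P0|move: P1|move: P2]; congr P; exact: val_inj.
  have HaV : H (Aut_class a^-1) by rewrite Aut_classV; exact: HV.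
  have HbV : H (Aut_class b^-1) by rewrite Aut_classV; exact: HV.
  have cZ : adjacency_closed Z.
    move=> j Psi Psi' [h Hh [->|->]] fP'.
    - elim/case3: j => adjP.
      + by exists h => //; right; exact: neighbor fl fl0 a0 fP' adjP.
      + exists (h * a^-1); first by rewrite Aut_classM; exact: HM.
        by right; rewrite flag_actM -Phi1E; exact: neighbor fl fl1 a1 fP' adjP.
      + exists (h * (b^-1 * a^-1)); first by rewrite !Aut_classM; apply: (HM) => //; exact: HM.
        by right; rewrite flag_actM -Phi2E; exact: neighbor fl fl2 a2 fP' adjP.
    - elim/case3: j => adjP.
      + exists h => //; left.
        exact: neighbor fl0 fl (flag_adjacent_sym a0) fP' adjP.
      + exists (h * a); first by rewrite Aut_classM; exact: HM.
        by left; rewrite flag_actM -aE; exact: neighbor fl0 fl01 a01 fP' adjP.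
      + exists (h * (a * b)); first by rewrite !Aut_classM; apply: (HM) => //; exact: HM.
        left; rewrite flag_actM; apply: neighbor fl0 _ abE fP' adjP.
        exact: is_flag_act.
  have ZPhi : Z Phi by exists 1 => //; left; rewrite flag_act1.
  have [h Hh [gh|gh]] := (all_flags hpq cZ fl ZPhi).1 _ (is_flag_act g fl).
    by rewrite (Aut_class_eq_flag fl gh).
  (* An automorphism cannot carry [Phi] to a translate of [Phi0], which lies in the other orbit. *)
  exfalso; apply: (alt _ _ _ fl fl0 a0).
  by rewrite -(flag_orbit_act g Phi) gh flag_orbit_act.
have fa : fixes_component 2 a Phi.
  rewrite /fixes_component -aE; case: (Phi) (Phi0) (Phi01) a0 a01.
  by move=> [? ?] ? [[? ?] ?] [[? ?] ?] [_ _ ->] [_ _ ->].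
have fb : fixes_component 0 b Phi.
  rewrite /fixes_component -bE; case: (Phi) (Phi1) (Phi12) a1 a12.
  by move=> [? ?] ? [[? ?] ?] [[? ?] ?] [-> _ _] [-> _ _].
have fab : fixes_component 1 (a * b) Phi.
  rewrite /fixes_component; case: (Phi) (Phi0) (flag_act (a * b) Phi) a0 abE.
  by move=> [? ?] ? [[? ?] ?] [[? ?] ?] [_ -> _] [_ -> _].
have tab : torsion (Aut_class a * Aut_class b).
  by rewrite -Aut_classM; exact: fixes_component_torsion fab.
split=> [[]|[] []] //.
- exact: fixes_component_torsion fa.
- exact: fixes_component_torsion fb.
- by rewrite -Aut_classM; apply: fixes_component_torsion (fl) (fixes_componentM fa fa).
- exact: torsion_mulC.
- by rewrite -Aut_classM; apply: fixes_component_torsion (fl) (fixes_componentM fb fb).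
Qed.

End FlagTransport.

(** * From torsion generators to the number of ends *)

Lemma generated_by_torsion_ends (R : realType) (G : groupType) (I : finType) (t : I -> G) (j0 : I) :
  generates (range t) -> (forall j, torsion (t j)) -> (forall j k, torsion (t j * t k)%g) ->
  finitely_generated G /\
  forall A : set G, finite_set A -> generates A ->
    group_Ends R A #= `I_0 \/ group_Ends R A #= `I_1.
Proof.
move=> gen_t tor tor2; split.
  by exists (range t) => //; apply: finite_image; exact: finite_finset.
move=> A fA genA; apply: ends_almost_invariant => // B.
exact: (almost_invariant_trivial gen_t tor tor2 j0).
Qed.

Theorem theorem1p2 (R : realType) (M : surface_map R)
    (hM : regular_map M \/ chiral_map M) :
  finitely_generated (Aut M) /\
  forall A : set (Aut M), finite_set A -> generates A ->
    group_Ends R A #= `I_0 \/ group_Ends R A #= `I_1.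
Proof.
case: hM => [[uniq_adj [p [q hpq]] orb]|[uniq_adj [p [q hpq]] orb alt]].
  have [t gen_t [tor tor2]] := regular_generators hpq uniq_adj orb.
  exact: (generated_by_torsion_ends R ord0 gen_t).
have [t gen_t [tor tor2]] := chiral_generators hpq uniq_adj orb alt.
exact: (generated_by_torsion_ends R true gen_t).
Qed.
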